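(* Let $\omega:[0,1]\to\mathbb{R}$ be a (nonconstant) c\`adl\`ag path, let $\mathbb{G}$ be its augmented graph, $\omega':\mathbb{G}\to\mathbb{R}$, $\omega'(t,x)=x$, the associated continuous path, and $\mathbb{T}$ its tree (see the context). Then $V_p(\omega)=V_p(\omega')$ for any $p\ge1$. In particular $\mathcal{V}(\omega')=\mathcal{V}(\omega)$, and $$\mathcal{V}(\omega)=\mathcal{H}(\mathbb{T})=\limsup_{a\to0}\frac{\log L^a}{\log(1/a)}+1=\Bigl(\limsup_{a\to0}\frac{\log N^a}{\log(1/a)}\Bigr)\vee1=\overline{\dim}\,\mathbb{T}.$$
   Context: Let $\omega:[0,1]\to\mathbb{R}$ be c\`adl\`ag (right-continuous with left limits), nonconstant, with the convention $\omega(0-)=\omega(0)$. Let $\mathbb{G}$ be the set of points $(t,x)$ with $0\le t\le1$ and $x$ between $\omega(t-)$ and $\omega(t)$ (inclusive), totally ordered by: $(t,x)\le(t',x')$ if $t<t'$, or $t=t'$ and $x$ is between $\omega(t-)$ and $x'$. With the order topology, $\mathbb{G}$ is homeomorphic to $[0,1]$ by an increasing bijection and $\omega'(t,x)=x$ is continuous on $\mathbb{G}$; moreover $\omega=\omega'\circ Q$ with $Q(t)=(t,\omega(t))$. Define $\delta((t,x),(t,x'))=|x'-x|$ and, for $s<t$, $\delta((s,x),(t,x'))=x+x'-2\bigl(\inf_{(s,t)}\omega\wedge x\wedge x'\bigr)$. This is a semi-distance on $\mathbb{G}$, and $\mathbb{T}=(\mathbb{G}/\delta,\delta)$ is a compact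 real tree (any two points $\tau_1,\tau_2$ are joined by a unique arc $[\tau_1,\tau_2]$, isometric to $[0,\delta(\tau_1,\tau_2)]$). Let $\pi:\mathbb{G}\to\mathbb{T}$ be the projection, and root $\mathbb{T}$ at $O=\pi(U,\omega(U)\wedge\omega(U-))$, where $U$ is a time with $\omega(U)\wedge\omega(U-)=\inf\omega$. A point $\tau_1$ is above $\tau_2$ if $\tau_2\in[O,\tau_1]$; a leaf is a point with no other point above it. The length measure $\lambda$ is the unique measure on $\mathbb{T}$ for which the set of leaves has measure zero and the measure of each arc is its length. For $\tau\in\mathbb{T}$, $h(\tau)=\sup\{\delta(\tau,\sigma):\sigma\text{ above }\tau\}$. For $a>0$, $\mathbb{T}^a=\{\tau\in\mathbb{T}:h(\tau)\ge a\}$, $N^a$ is the number of leaves of $\mathbb{T}^a$, and $L^a=\lambda(\mathbb{T}^a)$. For $p\ge1$, $V_p(\omega)=\sup\sum_i|\omega(t_{i+1})-\omega(t_i)|^p$ over finite increasing sequences $(t_i)$ in $[0,1]$; $V_p(\omega')$ is defined in the same way with finite increasing sequences in the totally ordered set $\mathbb{G}$. $\mathcal{V}(\cdot)=\inf\{p\ge1:V_p(\cdot)<\infty\}$ (with $\inf\varnothing=\infty$). Also $$\mathcal{H}(\mathbb{T})=\inf\Bigl\{p\ge1:\int_{\mathbb{T}}h(\tau)^{p-1}\lambda(d\tau)<\infty\Bigr\},\qquad \overline{\dim}\,\mathbb{T}=\limsup_{a\downarrow0}\frac{\log\mathcal{N}(a)}{\log(1/a)},$$ where $\mathcal{N}(a)$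 is the minimal number of balls of radius $a$ needed to cover $\mathbb{T}$. *)

(* Defs.v *)
From HB Require Import structures.
From mathcomp Require Import all_boot all_order all_algebra generic_quotient.
From mathcomp Require Import all_classical all_reals all_analysis.
From mathcomp Require Import lra.

Set Implicit Arguments.
Unset Strict Implicit.
Unset Printing Implicit Defensive.

Import Order.TTheory GRing.Theory Num.Theory.
Import numFieldNormedType.Exports.

Local Open Scope classical_set_scope.
Local Open Scope ring_scope.

Section variation.
Context {R : realType} {d : Order.disp_t} {T : orderType d}.
Implicit Types (A : set T) (f : T -> R) (p : R).

Definition pvar_sum f p (s : seq T) : R :=
  \sum_(xy <- zip s (behead s)) `|f xy.2 - f xy.1| `^ p.

Definition pvariation A f p : \bar R :=
  ereal_sup [set (pvar_sum f p s)%:E |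
             s in [set s | sorted <%O s /\ [set` s] `<=` A]].

Definition variation_index A f : \bar R :=
  ereal_inf [set p%:E | p in [set p | 1 <= p /\ (pvariation A f p < +oo)%E]].

End variation.

Section cadlag.
Context {R : realType}.
Implicit Types (w : R -> R) (t : R).

(* Only the values of w on [0, 1] matter. *)
Definition cadlag w : Prop :=
  (forall t, 0 <= t < 1 -> w x @[x --> t^'+] --> w t) /\
  (forall t, 0 < t <= 1 -> cvg (w x @[x --> t^'-])).

Definition left_lim w t : R :=
  if t == 0 then w 0 else lim (w x @[x --> t^'-]).

Lemma cadlag_lbound w : cadlag w ->
  exists m, forall t, t \in `[0, 1] -> m <= w t.
Proof.
move=> [wr wl].
have := @segment_compact R 0 1.
move/compact_near_coveringP => /(_ R (-oo%R)
  (fun i x => x \in `[0, 1] -> i <= w x)) H.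
have {}H : \forall i \near -oo%R,
    `[0, 1] `<=` (fun x => x \in `[0, 1] -> i <= w x).
  apply: H => x; rewrite /= in_itv/= => /andP[x0 x1].
  have [a ra] : exists a, \forall y \near x, x < y -> y <= 1 -> a <= w y.
    move: x1; rewrite le_eqVlt => /predU1P[->|x1].
      by exists 0; near=> y => /lt_geF ->.
    exists (w x - 1).
    have /cvgr_ge : w y @[y --> x^'+] --> w x by apply: wr; rewrite x0.
    move=> /(_ (w x - 1)); rewrite ltrBlDr ltrDl ltr01 => /(_ isT) h.
    by move: h; rewrite near_withinE => h; apply: filterS h => y h xy _; exact: h.
  have [b rb] : exists b, \forall y \near x, y < x -> 0 <= y -> b <= w y.
    move: x0; rewrite le_eqVlt => /predU1P[<-|x0].
      by exists 0; near=> y => /lt_geF ->.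
    exists (lim (w y @[y --> x^'-]) - 1).
    have /cvgr_ge : cvg (w y @[y --> x^'-]) by apply: wl; rewrite x0.
    move=> /(_ (lim (w y @[y --> x^'-]) - 1)).
    rewrite ltrBlDr ltrDl ltr01 => /(_ isT) h.
    by move: h; rewrite near_withinE => h; apply: filterS h => y h xy _; exact: h.
  pose m := Num.min (w x) (Num.min a b).
  exists ([set y | (x < y -> y <= 1 -> a <= w y) /\
                   (y < x -> 0 <= y -> b <= w y)], [set i | i < m]).
    split; first exact: filterI.
    by exists m; split => //; exact: num_real.
  move=> [y i]/= [[ya yb] /ltW im]; rewrite in_itv/= => /andP[y0 y1].
  apply: (le_trans im); rewrite /m !ge_min.
  case: (ltgtP x y) => [xy|yx|->]; last by rewrite lexx.
    by rewrite (ya xy y1) orbT.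
  by rewrite (yb yx y0) !orbT.
have [m [_ Hm]] := H; exists (m - 1) => t t01.
by apply: (Hm (m - 1)) => //; rewrite ltrBlDr ltrDl.
Unshelve. all: by end_near. Qed.

End cadlag.

Section graph.
Context {R : realType}.
Implicit Types (w : R -> R) (a b x : R).

Definition between a b x : bool := Num.min a b <= x <= Num.max a b.

Definition in_graph w (p : R * R) : bool :=
  (p.1 \in `[0, 1]) && between (left_lim w p.1) (w p.1) p.2.

Record graph w := Graph { graph_val :> R * R; _ : in_graph w graph_val }.

HB.instance Definition _ w := [isSub of graph w for @graph_val w].
HB.instance Definition _ w := [Choice of graph w by <:].

Definition time w (g : graph w) : R := (graph_val g).1.

Definition graph_path w (g : graph w) : R := (graph_val g).2.

Definition le_graph w (g g' : graph w) : bool :=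
  (time g < time g') ||
  (time g == time g') &&
  between (left_lim w (time g)) (graph_path g') (graph_path g).

Definition lt_graph w (g g' : graph w) : bool := (g' != g) && le_graph g g'.

Lemma graphP w (g : graph w) :
  (time g \in `[0, 1]) /\
  between (left_lim w (time g)) (w (time g)) (graph_path g).
Proof. by case: g => p pP; exact/andP. Qed.

Lemma le_graph_refl w : reflexive (@le_graph w).
Proof.
by move=> g; rewrite /le_graph eqxx /between le_max ge_min lexx !orbT.
Qed.

Lemma le_graph_anti w : antisymmetric (@le_graph w).
Proof.
move=> g g' /andP[]; rewrite /le_graph (eq_sym (time g')).
case: (ltgtP (time g) (time g')) => //= tt'.
rewrite -tt' /between !ge_min !le_max => h1 h2.
apply/val_inj; rewrite /= [LHS]surjective_pairing [RHS]surjective_pairing.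
congr pair; first exact: tt'.
apply/eqP; rewrite eq_le -/(graph_path g) -/(graph_path g'); lra.
Qed.

Lemma le_graph_trans w : transitive (@le_graph w).
Proof.
move=> g2 g1 g3; rewrite /le_graph => /orP[lt12|/andP[/eqP e12 b12]].
  move=> /orP[lt23|/andP[/eqP <- _]]; last by rewrite lt12.
  by rewrite (lt_trans lt12 lt23).
rewrite -e12 => /orP[->//|/andP[-> ]]; move: b12.
rewrite /between !ge_min !le_max => h1 h2; apply/orP; right => /=; lra.
Qed.

Lemma le_graph_total w : total (@le_graph w).
Proof.
move=> g g'; rewrite /le_graph (eq_sym (time g')).
case: (ltgtP (time g) (time g')) => //= tt'.
move: (graphP g).2 (graphP g').2; rewrite -tt' /between !ge_min !le_max.
lra.
Qed.

Fact graph_display : Order.disp_t. Proof. exact: (Order.Disp tt tt). Qed.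

HB.instance Definition _ w := @Order.isPOrder.Build graph_display (graph w)
  (@le_graph w) (@lt_graph w) (fun _ _ => erefl) (@le_graph_refl w)
  (@le_graph_anti w) (@le_graph_trans w).
HB.instance Definition _ w := @Order.POrder_isTotal.Build graph_display
  (graph w) (@le_graph_total w).

Lemma in_graph_low w t : t \in `[0, 1] ->
  in_graph w (t, Num.min (w t) (left_lim w t)).
Proof.
move=> t01; rewrite /in_graph /between t01/=; apply/andP; split.
  by rewrite minC.
by rewrite le_max !ge_min lexx orbT.
Qed.

Definition graph_low w t (t01 : t \in `[0, 1]) : graph w :=
  Graph (in_graph_low w t01).

Definition inf_oo w (s t : R) : R := inf [set w u | u in `]s, t[].

Definition graph_dist w (g g' : graph w) : R :=
  if time g == time g' then `|graph_path g' - graph_path g|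
  else graph_path g + graph_path g' -
       2 * Num.min (inf_oo w (Num.min (time g) (time g'))
                             (Num.max (time g) (time g')))
                   (Num.min (graph_path g) (graph_path g')).

(* The infimum of graph_path over the order interval between g and g'. *)
Definition graph_inf w (g g' : graph w) : R :=
  if time g == time g' then Num.min (graph_path g) (graph_path g')
  else Num.min (inf_oo w (Num.min (time g) (time g'))
                         (Num.max (time g) (time g')))
               (Num.min (graph_path g) (graph_path g')).

Lemma graph_distE w (g g' : graph w) :
  graph_dist g g' = graph_path g + graph_path g' - 2 * graph_inf g g'.
Proof.
rewrite /graph_dist /graph_inf; case: ifPn => // _.
case: (leP (graph_path g) (graph_path g')) => h.
  by rewrite ger0_norm ?subr_ge0//; lra.
by rewrite ltr0_norm ?subr_lt0//; lra.
Qed.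

Lemma graph_inf_le w (g g' : graph w) :
  graph_inf g g' <= graph_path g /\ graph_inf g g' <= graph_path g'.
Proof.
by rewrite /graph_inf; case: ifPn => _; rewrite !ge_min !lexx ?orbT.
Qed.

Lemma graph_distC w (g g' : graph w) : graph_dist g g' = graph_dist g' g.
Proof.
rewrite /graph_dist (eq_sym (time g)) (distrC (graph_path g')).
rewrite (minC (time g) (time g')) (maxC (time g) (time g')).
by rewrite (minC (graph_path g) (graph_path g'))
  (addrC (graph_path g) (graph_path g')).
Qed.

Lemma graph_distxx w (g : graph w) : graph_dist g g = 0.
Proof. by rewrite /graph_dist eqxx subrr normr0. Qed.

Lemma graph_dist_ge0 w (g g' : graph w) : 0 <= graph_dist g g'.
Proof. by rewrite graph_distE; have [] := graph_inf_le g g'; lra. Qed.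

Lemma inf_oo_le w s t u : cadlag w -> 0 <= s -> t <= 1 -> s < u < t ->
  inf_oo w s t <= w u.
Proof.
move=> /cadlag_lbound[m wm] s0 t1 /andP[su ut].
apply: ge_inf; last by exists u => //=; rewrite in_itv/= su.
exists m => y [v /=]; rewrite in_itv/= => /andP[sv vt] <-; apply: wm.
by rewrite in_itv/= (le_trans s0 (ltW sv)) (le_trans (ltW vt) t1).
Qed.

Lemma inf_oo_le_left w s t : cadlag w -> 0 <= s -> s < t -> t <= 1 ->
  inf_oo w s t <= w s.
Proof.
move=> cw s0 st t1.
have ws : w x @[x --> s^'+] --> w s.
  by apply: cw.1; rewrite s0 (lt_le_trans st t1).
apply: (@cvgr_to_ge _ _ _ _ _ _ _ ws).
near=> u; apply: inf_oo_le => //; apply/andP; split; near: u.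
  exact: nbhs_right_gt.
exact: nbhs_right_lt.
Unshelve. all: by end_near. Qed.

Lemma graph_inf_lt w (g g' : graph w) u : cadlag w ->
  Num.min (time g) (time g') < u < Num.max (time g) (time g') ->
  graph_inf g g' <= w u.
Proof.
move=> cw; have [] := (graphP g).1; have [] := (graphP g').1.
rewrite !in_itv/= /graph_inf => /andP[g'0 g'1] /andP[g0 g1] u12.
case: ifPn => [/eqP e|_]; first by move: u12; rewrite e minxx maxxx; lra.
rewrite ge_min; apply/orP; left; apply: inf_oo_le => //.
  by rewrite le_min g0.
by rewrite ge_max g1.
Qed.

Lemma graph_inf_left w (g g' : graph w) : cadlag w -> time g != time g' ->
  graph_inf g g' <= w (Num.min (time g) (time g')).
Proof.
move=> cw; have [] := (graphP g).1; have [] := (graphP g').1.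
rewrite !in_itv/= /graph_inf => /andP[g'0 g'1] /andP[g0 g1] /negbTE tt'.
rewrite tt' ge_min; apply/orP; left; apply: inf_oo_le_left => //.
- by rewrite le_min g0.
- by case: (ltgtP (time g) (time g')) tt'.
- by rewrite ge_max g1.
Qed.

Lemma graph_inf_ultra w (g1 g2 g3 : graph w) : cadlag w ->
  Num.min (graph_inf g1 g2) (graph_inf g2 g3) <= graph_inf g1 g3.
Proof.
move=> cw; rewrite [leRHS]/graph_inf.
have [m1 _] := graph_inf_le g1 g2; have [_ m3] := graph_inf_le g2 g3.
have m13 : Num.min (graph_inf g1 g2) (graph_inf g2 g3) <=
    Num.min (graph_path g1) (graph_path g3).
  by rewrite le_min !ge_min m1 m3 orbT.
case: ifPn => // t13; rewrite le_min m13 andbT.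
apply: lb_le_inf.
  have mM : Num.min (time g1) (time g3) < Num.max (time g1) (time g3).
    by case: (ltgtP (time g1) (time g3)) t13.
  have [h1 h2] := midf_lt mM.
  by eexists; exists ((Num.min (time g1) (time g3) +
    Num.max (time g1) (time g3)) / 2); rewrite //= in_itv/= h1 h2.
move=> y [u /=]; rewrite in_itv/= => /andP[u1 u3] <-; rewrite ge_min.
have [uE|u2] := eqVneq u (time g2).
  rewrite uE; move: u1 u3; rewrite uE gt_min lt_max => u1 u3.
  case: (ltgtP (time g1) (time g3)) t13 u1 u3 => // t13 _ u1 u3.
    have t23 : time g2 < time g3 by lra.
    have := @graph_inf_left w g2 g3 cw; rewrite (lt_eqF t23) => /(_ isT).
    by rewrite (min_l (ltW t23)) => ->; rewrite orbT.
  have t21 : time g2 < time g1 by lra.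
  have := @graph_inf_left w g1 g2 cw; rewrite (gt_eqF t21) => /(_ isT).
  by rewrite (min_r (ltW t21)) => ->.
suff [h|h] : Num.min (time g1) (time g2) < u < Num.max (time g1) (time g2) \/
    Num.min (time g2) (time g3) < u < Num.max (time g2) (time g3).
- by rewrite graph_inf_lt.
- by rewrite [X in _ || X]graph_inf_lt ?orbT.
move: u1 u3 u2; rewrite !gt_min !lt_max neq_lt => u1 u3 u2; lra.
Qed.

Lemma graph_dist_triangle w (g1 g2 g3 : graph w) : cadlag w ->
  graph_dist g1 g3 <= graph_dist g1 g2 + graph_dist g2 g3.
Proof.
move=> cw; rewrite !graph_distE.
have := graph_inf_ultra g1 g2 g3 cw.
have [_ h1] := graph_inf_le g1 g2; have [h2 _] := graph_inf_le g2 g3.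
by rewrite ge_min => /orP[]; lra.
Qed.

End graph.

Section tree.
Context {R : realType} (w : R -> R) (cw : cadlag w).

Definition graph_rel (g g' : graph w) : bool := graph_dist g g' == 0.

Let graph_rel_refl : reflexive graph_rel.
Proof. by move=> g; rewrite /graph_rel graph_distxx. Qed.

Let graph_rel_sym : symmetric graph_rel.
Proof. by move=> g g'; rewrite /graph_rel graph_distC. Qed.

Let graph_rel_trans : transitive graph_rel.
Proof.
move=> g2 g1 g3 /eqP e12 /eqP e23; rewrite /graph_rel eq_le graph_dist_ge0.
by rewrite andbT (le_trans (graph_dist_triangle g1 g2 g3 cw))// e12 e23 addr0.
Qed.

Canonical graph_equiv :=
  EquivRel graph_rel graph_rel_refl graph_rel_sym graph_rel_trans.

Local Open Scope quotient_scope.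

Definition tree : Type := {eq_quot graph_equiv}.
HB.instance Definition _ := Choice.on tree.
HB.instance Definition _ := EqQuotient.on tree.

Definition tree_dist (x y : tree) : R := graph_dist (repr x) (repr y).

Let graph_dist_congr (g1 g1' g2 : graph w) :
  graph_dist g1 g1' = 0 -> graph_dist g1 g2 = graph_dist g1' g2.
Proof.
move=> e; apply/eqP; rewrite eq_le; apply/andP; split.
  by rewrite (le_trans (graph_dist_triangle _ g1' _ cw))// e add0r.
by rewrite (le_trans (graph_dist_triangle _ g1 _ cw))// graph_distC e add0r.
Qed.

Lemma tree_dist_pi (g g' : graph w) :
  tree_dist (\pi_tree g) (\pi_tree g') = graph_dist g g'.
Proof.
have h (k : graph w) : graph_dist (repr (\pi_tree k)) k = 0.
  apply/eqP; have : repr (\pi_tree k) = k %[mod tree] by rewrite reprK.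
  by move/eqquotP.
by rewrite /tree_dist (graph_dist_congr _ (h g)) graph_distC
  (graph_dist_congr _ (h g')) graph_distC.
Qed.

Let tree_distxx x : tree_dist x x = 0.
Proof. exact: graph_distxx. Qed.

Let tree_dist_positivity x y : tree_dist x y = 0 -> x = y.
Proof.
by move=> /eqP h; rewrite -[x]reprK -[y]reprK; apply/eqquotP.
Qed.

Let tree_distC x y : tree_dist x y = tree_dist y x.
Proof. exact: graph_distC. Qed.

Let tree_dist_triangle y x z : tree_dist x z <= tree_dist x y + tree_dist y z.
Proof. exact: graph_dist_triangle. Qed.

HB.instance Definition _ := isMetric.Build R tree
  tree_distxx tree_dist_positivity tree_distC tree_dist_triangle.

Let in01_0 : (0 : R) \in `[0, 1].
Proof. by rewrite in_itv/= lexx ler01. Qed.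

HB.instance Definition _ :=
  isPointed.Build tree (\pi_tree (graph_low w in01_0)).

End tree.

Definition borel (T : ptopologicalType) := g_sigma_algebraType (@open T).

Definition growth_exponent {R : realType} (f : R -> \bar R) : \bar R :=
  limf_esup (fun a => lne (f a) / (ln a^-1)%:E)%E 0^'+.

Section metric.
Context {R : realType} {T : metricType R}.
Implicit Types (x y : T) (A : set T).

(* The union of the isometric arcs from x to y: a real tree has exactly one. *)
Definition arc x y : set T :=
  [set z | exists f : R -> T,
    [/\ f 0 = x, f (mdist x y) = y,
        {in `[0, mdist x y] &, forall s t, mdist (f s) (f t) = `|s - t|} &
        (f @` `[0, mdist x y]) z]].

(* x is above y in the tree rooted at O. *)
Definition above (O x y : T) : Prop := arc O x y.

(* Meant for subtrees A containing O, so that A inherits the root and the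
   arcs of T. *)
Definition leaves (O : T) A : set T :=
  [set x | A x /\ forall y, A y -> above O y x -> y = x].

Definition height (O x : T) : R :=
  sup [set mdist x y | y in [set y | above O y x]].

Definition trim (O : T) (a : R) : set T := [set x | a <= height O x].

Definition nleaves (O : T) (a : R) : \bar R := counting (leaves O (trim O a)).

(* Balls are open; +oo if there is no finite covering. *)
Definition covering_number (a : R) : \bar R :=
  ereal_inf [set (size s)%:R%:E | s in
    [set s : seq T | forall y, exists2 x, x \in s & ball x a y]].

End metric.

Section length_measure.
Context {R : realType} {w : R -> R} {cw : cadlag w}.
Local Notation T := (tree cw).
Implicit Types (O : T) (lam : {measure set (borel T) -> \bar R}).

Definition is_length_measure O lam : Prop :=
  lam (leaves O setT) = 0%E /\ forall x y : T, lam (arc x y) = (mdist x y)%:E.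

Definition trim_length O lam (a : R) : \bar R := lam (trim O a).

Definition height_index O lam : \bar R :=
  ereal_inf [set p%:E | p in [set p : R | 1 <= p /\
    (\int[lam]_(x in setT) (height O x `^ (p - 1))%:E < +oo)%E]].

End length_measure.

Definition upper_dim {R : realType} (T : metricType R) : \bar R :=
  growth_exponent (@covering_number R T).

(* Main.v *)
Require Import Defs.
From mathcomp Require Import all_boot all_order all_algebra generic_quotient.
From mathcomp Require Import all_classical all_reals all_analysis.
From mathcomp Require Import ring lra measurable_realfun.
Set Implicit Arguments.
Unset Strict Implicit.
Unset Printing Implicit Defensive.
Import Order.TTheory GRing.Theory Num.Theory.
Import numFieldNormedType.Exports.
Local Open Scope classical_set_scope.
Local Open Scope ring_scope.
Local Open Scope quotient_scope.

(* The five indices are compared in a cycle,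
     V <= H <= limsup log L^a / log (1/a) + 1 <= (limsup log N^a / log (1/a)) \/ 1
       <= dim <= V.
   - The increments of w' along g_1 < g_2 < ... climb and descend arcs of the
     tree. Since the points of the graph lying above a given point of the tree
     form an interval, the climbed arcs are disjoint, and so are the descended
     ones; when the level changes by d, the middle third of the arc between the two
     levels consists of points of height at least d / 3, so that
     V_p <= 2 * 3^p * int h^(p-1).
   - H is bounded by cutting int h^(p-1) into dyadic layers of the height.
   - T^a \ T^2a is covered by the arcs of length a below the leaves of T^a, so
     that L^a <= L^2a + a N^a.
   - The points of maximal height above the leaves of T^a are 2a-separated, hence
     N^a is at most the number of a-balls in a covering; such a covering has at
     least c / a balls because the levels fill an interval.
   - Consecutive points of an a-separated set, ordered along the graph, enclose an
     increment of w' of size at least a / 3, so that it has at most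
     1 + V_p (3/a)^p elements.
   Besides the order of the graph, all that is needed of the tree is the inequality
   min(m(x, y), m(y, z)) <= m(x, z) for the Gromov product m from the root, the
   existence of points at every level below a given point, and compactness. *)

(** * Sums of powers of increments *)

Section power_variation.
Context {R : realType}.
Implicit Types (p x y C : R) (s : seq R).

Definition psum p s : R := \sum_(xy <- zip s (behead s)) `|xy.2 - xy.1| `^ p.

Lemma psum_cons2 p x y s : psum p [:: x, y & s] = `|y - x| `^ p + psum p (y :: s).
Proof. by rewrite /psum /= big_cons. Qed.

Lemma psum1 p x : psum p [:: x] = 0.
Proof. by rewrite /psum /= big_nil. Qed.

Lemma psum_cat p s1 x s2 :
  psum p (s1 ++ x :: s2) = psum p (rcons s1 x) + psum p (x :: s2).
Proof.
elim: s1 => [|y s1 ih] /=; first by rewrite psum1 add0r.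
case: s1 ih => [_|z s1 ih] /=; first by rewrite !psum_cons2 psum1 addr0.
by rewrite !psum_cons2 ih addrA.
Qed.

Lemma psum_dup p s1 x s2 : 0 < p ->
  psum p (s1 ++ [:: x, x & s2]) = psum p (s1 ++ x :: s2).
Proof.
move=> p0; rewrite !psum_cat psum_cons2 subrr normr0 powR0 ?gt_eqF//.
by rewrite add0r.
Qed.

(** One entry enters only through the terms joining it to its neighbours, which [ys] lists.
    Convexity and continuity of the sum in that entry are read off this form. *)
Lemma psum_insert p s1 s2 : exists c ys, forall x,
  psum p (s1 ++ x :: s2) = c + \sum_(y <- ys) `|x - y| `^ p.
Proof.
have [c1 [y1 e1]] : exists c ys, forall x,
    psum p (rcons s1 x) = c + \sum_(y <- ys) `|x - y| `^ p.
  case/lastP: s1 => [|s1 y]; first by exists 0, [::] => x; rewrite psum1 big_nil addr0.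
  exists (psum p (rcons s1 y)), [:: y] => x.
  by rewrite -!cats1 -catA /= psum_cat psum_cons2 psum1 addr0 big_seq1 cats1.
have [c2 [y2 e2]] : exists c ys, forall x,
    psum p (x :: s2) = c + \sum_(y <- ys) `|x - y| `^ p.
  case: s2 => [|y s2]; first by exists 0, [::] => x; rewrite psum1 big_nil addr0.
  by exists (psum p (y :: s2)), [:: y] => x; rewrite psum_cons2 big_seq1 distrC addrC.
exists (c1 + c2), (y1 ++ y2) => x.
by rewrite psum_cat e1 e2 big_cat/= addrACA.
Qed.

Lemma convex_dist_powR p a b x y (t : R) : 1 <= p -> 0 <= t <= 1 ->
  x = t * a + (1 - t) * b ->
  `|x - y| `^ p <= t * `|a - y| `^ p + (1 - t) * `|b - y| `^ p.
Proof.
move=> p1 /andP[t0 t1] ->.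
have t1' : 0 <= 1 - t by rewrite subr_ge0.
pose t' := Itv01 t0 t1.
have := @convex_powR R p p1 t' `|a - y| `|b - y|.
rewrite !inE/= !in_itv/= !andbT !normr_ge0 => /(_ isT isT).
rewrite !convRE/= => h; apply: le_trans h.
apply: ge0_ler_powR; rewrite ?nnegrE ?(le_trans _ p1) ?normr_ge0 //.
  by rewrite addr_ge0// mulr_ge0.
have -> : t * a + (1 - t) * b - y = t * (a - y) + (1 - t) * (b - y) by ring.
by apply: le_trans (ler_normD _ _) _; rewrite !normrM (ger0_norm t0) (ger0_norm t1').
Qed.

(** On a segment, a convex function of the entry is at most the larger of its values at the end
    points. *)
Lemma psum_convex p s1 s2 a b x C : 1 <= p -> between a b x ->
  psum p (s1 ++ a :: s2) <= C -> psum p (s1 ++ b :: s2) <= C ->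
  psum p (s1 ++ x :: s2) <= C.
Proof.
move=> p1 xab; have [c [ys e]] := psum_insert p s1 s2; rewrite !e => ha hb.
have [t t01 xE] : exists2 t, 0 <= t <= 1 & x = t * a + (1 - t) * b.
  have [ab|ab] := eqVneq a b.
    exists 0; first by rewrite lexx ler01.
    move: xab; rewrite /between ab minxx maxxx => h; apply/eqP.
    by rewrite eq_le mul0r add0r subr0 mul1r andbC.
  have ba0 : a - b != 0 by rewrite subr_eq0.
  exists ((x - b) / (a - b)); last by field.
  move: xab; rewrite /between; case: (ltgtP a b) ab => // ab _ /andP[h1 h2].
    rewrite ler_ndivlMr ?ler_ndivrMr ?subr_lt0//; lra.
  rewrite ler_pdivlMr ?ler_pdivrMr ?subr_gt0//; lra.
have : \sum_(y <- ys) `|x - y| `^ p <= t * (\sum_(y <- ys) `|a - y| `^ p)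
    + (1 - t) * (\sum_(y <- ys) `|b - y| `^ p).
  rewrite !mulr_sumr -big_split/=; apply: ler_sum => y _.
  exact: convex_dist_powR.
set A := \sum_(y <- ys) `|a - y| `^ p in ha *.
set B := \sum_(y <- ys) `|b - y| `^ p in hb *.
have /andP[t0 t1] := t01; move=> h; apply: (le_trans (lerD (lexx c) h)).
have h1 := ler_wpM2l t0 ha; have t1' : 0 <= 1 - t by rewrite subr_ge0.
have h2 := ler_wpM2l t1' hb; lra.
Qed.

Lemma cvg_norm_powR {T} {F : set_system T} {FF : Filter F} (f : T -> R) p x : 0 < p ->
  f @ F --> x -> (fun u => `|f u| `^ p) @ F --> `|x| `^ p.
Proof.
move=> p0 fx; have nfx : `|f u| @[u --> F] --> `|x| by apply: cvg_norm.
(* The power is differentiable away from 0; at 0 the threshold is the p-th root of [e]. *)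
have [x0|x0] := eqVneq x 0; last first.
  have nx0 : 0 < `|x| by rewrite normr_gt0.
  have h : {for `|x|, continuous (fun a : R => a `^ p)}.
    apply: differentiable_continuous; apply/derivable1_diffP.
    by apply: derivable_powR; rewrite in_itv/= nx0.
  exact: cvg_comp nfx h.
rewrite x0 normr0 powR0 ?gt_eqF//; apply/cvgrPdist_le => e e0.
have e1 : 0 < e `^ p^-1 by exact: powR_gt0.
rewrite x0 normr0 in nfx; have h := @cvgr_dist_lt _ _ _ _ _ _ _ nfx _ e1.
apply: filterS (h FF) => u; rewrite !sub0r !normrN normr_id => /ltW fu.
rewrite ger0_norm ?powR_ge0//.
have -> : e = (e `^ p^-1) `^ p.
  by rewrite -powRrM mulVf ?gt_eqF// powRr1// ltW.
by apply: ge0_ler_powR; rewrite ?nnegrE ?(ltW p0) ?(ltW e1) ?normr_ge0.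
Qed.

Lemma psum_closed p s1 s2 x C {T} {F : set_system T}
    {FF : ProperFilter F} (f : T -> R) : 0 < p -> f @ F --> x ->
  (\forall u \near F, psum p (s1 ++ f u :: s2) <= C) ->
  psum p (s1 ++ x :: s2) <= C.
Proof.
move=> p0 fx h; have [c [ys e]] := psum_insert p s1 s2.
suff cv : psum p (s1 ++ f u :: s2) @[u --> F] --> psum p (s1 ++ x :: s2).
  exact: cvgr_to_le cv h.
have -> : (fun u => psum p (s1 ++ f u :: s2)) =
    (fun u => c + \sum_(y <- ys) `|f u - y| `^ p) by apply/funext => u; exact: e.
rewrite e; apply: cvgD; first exact: cvg_cst.
apply: (@cvg_big _ _ +%R 0 xpredT add_continuous) => y _.
by apply: cvg_norm_powR => //; apply: cvgB => //; exact: cvg_cst.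
Qed.

Lemma psum_pvar_sum d (T : orderType d) (f : T -> R) p (s : seq T) :
  pvar_sum f p s = psum p (map f s).
Proof.
rewrite /pvar_sum; elim: s => [|x [|y s] ih]; rewrite ?psum1 ?/psum/= ?big_nil//.
by rewrite -/(psum p [:: f x, f y & map f s]) psum_cons2 big_cons/= ih.
Qed.

Lemma pvar_sum_le_sorted d (T : orderType d) (A : set T) (f : T -> R) p (s : seq T) :
  0 < p -> sorted <=%O s -> [set` s] `<=` A ->
  ((pvar_sum f p s)%:E <= pvariation A f p)%E.
Proof.
move=> p0 ss sA.
have [s' [ss' sub <-]] : exists s' : seq T, [/\ sorted <%O s', {subset s' <= s} &
    pvar_sum f p s' = pvar_sum f p s].
  case: s ss {sA} => [|x s] /= ss; first by exists [::].
  suff [s' [h1 h2 h3]] : exists s' : seq T, [/\ path <%O x s', {subset s' <= x :: s} &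
      pvar_sum f p (x :: s') = pvar_sum f p (x :: s)].
    exists (x :: s'); split => // y; rewrite in_cons => /predU1P[->|/h2//].
    exact: mem_head.
  elim: s x ss => [|y s ih] x /=; first by exists [::].
  move=> /andP[xy /ih [s' [h1 h2 h3]]].
  move: h3; rewrite !psum_pvar_sum /= => h3.
  have [xyE|xyN] := eqVneq x y.
    exists s'; rewrite xyE; split => //.
      by move=> z /h2 h; rewrite in_cons h orbT.
    by rewrite !psum_pvar_sum /= psum_cons2 subrr normr0 powR0 ?gt_eqF// add0r.
  exists (y :: s'); split => /=; first by rewrite lt_neqAle xyN xy.
    move=> z; rewrite !in_cons => /predU1P[->|/h2]; first by rewrite eqxx orbT.
    by rewrite in_cons => ->; rewrite orbT.
  by rewrite !psum_pvar_sum /= !psum_cons2 h3.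
apply: ereal_sup_ubound; exists s' => //; split => // x /= /sub.
exact: sA.
Qed.

Lemma pvariation_ge0 d (T : orderType d) (A : set T) (f : T -> R) p :
  (0 <= pvariation A f p)%E.
Proof.
apply: ereal_sup_ubound; exists [::]; first by split => // x.
by rewrite psum_pvar_sum /psum/= big_nil.
Qed.

End power_variation.

(** * Variation along the graph *)

Section cadlag_limits.
Context {R : realType} (w : R -> R).
Hypothesis cw : cadlag w.

Lemma cvg_right_cadlag t : 0 <= t < 1 -> w x @[x --> t^'+] --> w t.
Proof. exact: cw.1. Qed.

Lemma cvg_left_cadlag t : 0 < t <= 1 -> w x @[x --> t^'-] --> left_lim w t.
Proof.
move=> t01; rewrite /left_lim gt_eqF; last by case/andP: t01.
exact: cw.2.
Qed.

End cadlag_limits.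

Section graph_points.
Context {R : realType} (w : R -> R).

Lemma left_lim0 : left_lim w 0 = w 0.
Proof. by rewrite /left_lim eqxx. Qed.

Lemma betweenl (a b : R) : between a b a.
Proof. by rewrite /between ge_min le_max !lexx. Qed.

Lemma betweenr (a b : R) : between a b b.
Proof. by rewrite /between ge_min le_max !lexx !orbT. Qed.

Lemma in_graph_low0 : in_graph w (0, w 0).
Proof. by rewrite /in_graph/= in_itv/= lexx ler01/= betweenr. Qed.

(** Made total by [insubd]: outside the unit interval the value is the point (0, w 0). *)
Definition graph_pt (t : R) : graph w := insubd (Graph in_graph_low0) (t, w t).

Lemma val_graph_pt t : t \in `[0, 1] -> val (graph_pt t) = (t, w t).
Proof. by move=> t01; rewrite /graph_pt insubdK// unfold_in /in_graph/= t01 betweenr. Qed.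

Lemma time_graph_pt t : t \in `[0, 1] -> time (graph_pt t) = t.
Proof. by move=> t01; rewrite /time -/(val (graph_pt t)) val_graph_pt. Qed.

Lemma path_graph_pt t : t \in `[0, 1] -> graph_path (graph_pt t) = w t.
Proof. by move=> t01; rewrite /graph_path -/(val (graph_pt t)) val_graph_pt. Qed.

Lemma le_graphE (g h : graph w) : (g <= h)%O = le_graph g h.
Proof. by []. Qed.

Lemma le_time (g h : graph w) : (g <= h)%O -> time g <= time h.
Proof. by rewrite le_graphE => /orP[/ltW//|/andP[/eqP-> _]]. Qed.

Lemma lt_time_le (g h : graph w) : time g < time h -> (g <= h)%O.
Proof. by rewrite le_graphE /le_graph => ->. Qed.

Lemma time01 (g : graph w) : time g \in `[0, 1].
Proof. exact: (graphP g).1. Qed.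

Lemma time_bounds (g : graph w) : 0 <= time g <= 1.
Proof. by have := time01 g; rewrite in_itv. Qed.

End graph_points.

Lemma near_seq {T} {F : set_system T} {FF : Filter F} {I : eqType} (s : seq I)
    (P : I -> T -> Prop) : (forall i, i \in s -> \forall u \near F, P i u) ->
  \forall u \near F, forall i, i \in s -> P i u.
Proof.
elim: s => [|i s ih] h; first by near=> u.
have h1 := h i (mem_head _ _).
have h2 : \forall u \near F, forall j, j \in s -> P j u.
  by apply: ih => j js; apply: h; rewrite in_cons js orbT.
apply: filterS2 h1 h2 => u iu su j; rewrite in_cons => /predU1P[->//|].
exact: su.
Unshelve. all: by end_near. Qed.

Section variation_graph.
Context {R : realType} (w : R -> R) (cw : cadlag w).

(* The points of the sequence are replaced from left to right by points of the
   form (t, w t). A point (t, x) ranges over a segment with end points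
   (t, left_lim w t), which is a limit of points (u, w u), and either (t, w t)
   or the next point of the sequence; the sum is convex in x. *)
Lemma psum_graph_le p C : 1 <= p ->
  (forall s : seq R, sorted <=%R s -> {subset s <= `[0, 1]} ->
     psum p (map w s) <= C) ->
  forall s : seq (graph w), sorted <=%O s -> psum p (map (@graph_path R w) s) <= C.
Proof.
move=> p1 hC s; have p0 : 0 < p by rewrite (lt_le_trans ltr01).
suff H (s2 : seq (graph w)) (ts : seq R) : pairwise <=%R ts -> {subset ts <= `[0, 1]} ->
    (forall u g, u \in ts -> g \in s2 -> (graph_pt w u <= g)%O) ->
    pairwise <=%O s2 -> psum p (map w ts ++ map (@graph_path R w) s2) <= C.
  by rewrite sorted_pairwise; [exact: (H s [::])|exact: le_trans].
elim: s2 ts => [|g s2 ih] ts sts t01 tsg; rewrite /=.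
  by rewrite cats0 => _; apply: hC => //; rewrite sorted_pairwise//; exact: le_trans.
move=> /andP[/allP gs2 ss2].
have push u : u \in `[0, 1] -> (forall v, v \in ts -> v <= u) ->
    (forall h, h \in s2 -> (graph_pt w u <= h)%O) ->
    psum p (map w ts ++ w u :: map (@graph_path R w) s2) <= C.
  move=> u01 uts us2; rewrite -cat_rcons -map_rcons; apply: ih => //.
  - rewrite pairwise_rcons sts andbT; apply/allP => v /uts.
    by [].
  - by move=> v; rewrite mem_rcons in_cons => /predU1P[->//|/t01].
  - move=> v h; rewrite mem_rcons in_cons => /predU1P[->|vts] hs2; first exact: us2.
    by apply: tsg => //; rewrite in_cons hs2 orbT.
have ts_le v : v \in ts -> v <= time g.
  move=> vts; have := tsg v g vts (mem_head _ _) => /le_time.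
  by rewrite time_graph_pt// t01.
have [gE|gN] := eqVneq (graph_path g) (w (time g)).
  rewrite gE; apply: push => //; first exact: time01.
  move=> h /gs2; suff -> : graph_pt w (time g) = g by [].
  apply/val_inj; rewrite val_graph_pt ?time01// -gE.
  by rewrite /time /graph_path -surjective_pairing.
have t0 : 0 < time g.
  have /andP[] := time_bounds g; rewrite le_eqVlt => /predU1P[t0|//] _.
  have := (graphP g).2; move: gN; rewrite -t0 left_lim0 /between minxx maxxx.
  by move=> + h; rewrite eq_le andbC h.
(* The point [(v, w v)] is the greatest at its time, so an earlier one at the time of [g] would
   force [g] to be of this form too. *)
have ts_lt v : v \in ts -> v < time g.
  move=> vts; rewrite lt_neqAle ts_le// andbT; apply: contra gN => /eqP vE.
  have := tsg v g vts (mem_head _ _).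
  have := (graphP g).2; rewrite le_graphE /le_graph time_graph_pt ?t01//.
  rewrite path_graph_pt ?t01// -vE ltxx eqxx/= /between !ge_min !le_max => h1 h2.
  by rewrite eq_le; lra.
have lft : psum p (map w ts ++ left_lim w (time g) :: map (@graph_path R w) s2) <= C.
  have /andP[_ tg1] := time_bounds g.
  have := @cvg_left_cadlag _ _ cw (time g); rewrite t0.
  move=> /(_ tg1) /psum_closed; apply => //.
  near=> u; apply: push.
  - rewrite in_itv/=; apply/andP; split; last first.
      by rewrite (le_trans _ tg1)//; near: u; exact: nbhs_left_le.
    by near: u; exact: nbhs_left_ge.
  - near: u; apply: near_seq => v vts.
    exact/nbhs_left_ge/ts_lt.
  - move=> h /gs2 /le_time gh; apply: lt_time_le; rewrite time_graph_pt.
      by apply: lt_le_trans gh; near: u; exact: nbhs_left_lt.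
    rewrite in_itv/=; apply/andP; split; last first.
      by rewrite (le_trans _ tg1)//; near: u; exact: nbhs_left_le.
    by near: u; exact: nbhs_left_ge.
suff [hi gb hiC] : exists2 hi, between (left_lim w (time g)) hi (graph_path g) &
    psum p (map w ts ++ hi :: map (@graph_path R w) s2) <= C.
  exact: psum_convex gb lft hiC.
case: s2 ih gs2 ss2 tsg push lft => [|h s2] ih gs2 ss2 tsg push lft.
  exists (w (time g)); first exact: (graphP g).2.
  by apply: push => //; exact: time01.
have [th|th] := eqVneq (time h) (time g).
  exists (graph_path h).
    have := gs2 h (mem_head _ _); rewrite le_graphE /le_graph th ltxx eqxx/=.
    by [].
  rewrite /= psum_dup//; apply: (ih ts) => // u k uts ks.
  by apply: tsg => //; rewrite in_cons ks orbT.
exists (w (time g)); first exact: (graphP g).2.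
apply: push => //; first exact: time01.
have {}th : time g < time h.
  by rewrite lt_neqAle eq_sym th le_time// gs2// mem_head.
move=> k; rewrite in_cons => /predU1P[->|ks].
  by apply: lt_time_le; rewrite time_graph_pt// time01.
apply: lt_time_le; rewrite time_graph_pt ?time01//.
apply: (lt_le_trans th); apply: le_time.
by move: ss2 => /= /andP[/allP + _]; apply.
Unshelve. all: by end_near. Qed.

Lemma pvariation_graph p : 1 <= p ->
  pvariation `[0, 1] w p = pvariation setT (@graph_path R w) p.
Proof.
move=> p1; have p0 : 0 < p by rewrite (lt_le_trans ltr01).
apply/eqP; rewrite eq_le; apply/andP; split.
  apply: ge_ereal_sup => _ [s [ss s01] <-].
  have -> : pvar_sum w p s = pvar_sum (@graph_path R w) p (map (graph_pt w) s).
    rewrite !psum_pvar_sum -map_comp; congr psum; apply/eq_in_map => t ts /=.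
    by rewrite path_graph_pt//; exact: s01.
  apply: pvar_sum_le_sorted => //.
    apply: (homo_sorted_in (P := [pred t | t \in `[0, 1]])) ss; last first.
      by apply/allP => t /s01.
    move=> t u; rewrite !inE => t01 u01 tu; apply: lt_time_le.
    by rewrite !time_graph_pt.
set V := pvariation `[0, 1] w p.
have [->|voo] := eqVneq V +oo%E; first by rewrite leey.
have vfin : V \is a fin_num by rewrite ge0_fin_numE ?pvariation_ge0// lt_neqAle voo leey.
apply: ge_ereal_sup => _ [s [ss _] <-].
rewrite -(fineK vfin) lee_fin psum_pvar_sum; apply: psum_graph_le => //.
  move=> s' ss' s'01; rewrite -lee_fin fineK// -psum_pvar_sum.
  by apply: pvar_sum_le_sorted => // x /s'01.
by move: ss; rewrite lt_sorted_uniq_le => /andP[].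
Qed.

End variation_graph.

(** * The graph of a cadlag path *)

Section graph_local.
Context {R : realType} (w : R -> R) (cw : cadlag w).
Implicit Types (g h : graph w) (t u c e : R).

Lemma path_dist_le g c e : `|w (time g) - c| <= e -> `|left_lim w (time g) - c| <= e ->
  `|graph_path g - c| <= e.
Proof.
have := (graphP g).2; rewrite /between ge_min le_max !ler_distl => h.
by move=> /andP[a1 a2] /andP[b1 b2]; lra.
Qed.

(** Values of [w] close to [w t] have left limits close to [w t], and points of the graph lie
    between the two, so the jumps just after [t] are controlled as well. *)
Lemma near_right_path t e : 0 <= t < 1 -> 0 < e ->
  exists2 d, 0 < d & forall g, t < time g < t + d -> `|graph_path g - w t| <= e.
Proof.
move=> t01 e0; have /cvgrPdist_le/(_ _ e0) := cvg_right_cadlag cw t01.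
rewrite near_withinE => -[d /= d0 hd]; exists d => // g /andP[tg gd].
have hw u : t < u -> u <= time g -> `|w u - w t| <= e.
  move=> tu ug; rewrite distrC; apply: hd => //=.
  by rewrite ltr_distlC; lra.
apply: path_dist_le; first exact: hw.
have tg01 : 0 < time g <= 1 by have := time_bounds g; lra.
have cl := cvg_left_cadlag cw tg01.
have cl' : `|w u - w t| @[u --> (time g)^'-] --> `|left_lim w (time g) - w t|.
  by apply: cvg_norm; apply: cvgB cl _; exact: cvg_cst.
apply: (cvgr_to_le cl'); near=> u; apply: hw.
  by near: u; exact: nbhs_left_gt.
by near: u; exact: nbhs_left_le.
Unshelve. all: by end_near. Qed.

Lemma near_left_path t e : 0 < t <= 1 -> 0 < e ->
  exists2 d, 0 < d & forall g, t - d < time g < t -> `|graph_path g - left_lim w t| <= e.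
Proof.
move=> t01 e0; have /cvgrPdist_le/(_ _ e0) := cvg_left_cadlag cw t01.
rewrite near_withinE => -[d /= d0 hd]; exists d => // g /andP[tg gd].
have hw u : t - d < u -> u <= time g -> `|w u - left_lim w t| <= e.
  move=> tu ug; rewrite distrC; apply: hd => /=; last by apply: le_lt_trans gd.
  by rewrite ltr_distlC; lra.
apply: path_dist_le; first exact: hw.
have := time_bounds g; rewrite le_eqVlt => /andP[/predU1P[g0|g0] g1].
  by rewrite -g0 left_lim0; apply: hw; rewrite ?g0.
have cl : w u @[u --> (time g)^'-] --> left_lim w (time g).
  by apply: cvg_left_cadlag => //; rewrite g0.
have cl' : `|w u - left_lim w t| @[u --> (time g)^'-] -->
    `|left_lim w (time g) - left_lim w t|.
  by apply: cvg_norm; apply: cvgB cl _; exact: cvg_cst.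
apply: (cvgr_to_le cl'); near=> u; apply: hw.
  by near: u; exact: nbhs_left_gt.
by near: u; exact: nbhs_left_le.
Unshelve. all: by end_near. Qed.

Lemma inf_oo_ge s t c : s < t -> (forall u, s < u < t -> c <= w u) -> c <= inf_oo w s t.
Proof.
move=> st h; apply: lb_le_inf.
  have [h1 h2] := midf_lt st.
  by eexists; exists ((s + t) / 2); rewrite //= in_itv/= h1 h2.
by move=> y [u /=]; rewrite in_itv/= => su <-; exact: h.
Qed.

Lemma inf_oo_le_right s t : 0 <= s -> s < t -> t <= 1 -> inf_oo w s t <= left_lim w t.
Proof.
move=> s0 st t1; have t01 : 0 < t <= 1 by rewrite t1 (le_lt_trans s0).
apply: (cvgr_to_ge (cvg_left_cadlag cw t01)); near=> u.
apply: inf_oo_le => //; apply/andP; split.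
  by near: u; exact: nbhs_left_gt.
by near: u; exact: nbhs_left_lt.
Unshelve. all: by end_near. Qed.

Lemma inf_oo_subset s t s' t' : 0 <= s -> s <= s' -> s' < t' -> t' <= t -> t <= 1 ->
  inf_oo w s t <= inf_oo w s' t'.
Proof.
move=> s0 ss' st tt' t1; apply: inf_oo_ge => // u /andP[s'u ut'].
by apply: inf_oo_le => //; lra.
Qed.

Lemma graph_inf_ge g h c : c <= graph_path g -> c <= graph_path h ->
  (forall u, Num.min (time g) (time h) < u < Num.max (time g) (time h) -> c <= w u) ->
  c <= graph_inf g h.
Proof.
move=> cg ch hc; rewrite /graph_inf; case: ifPn => gh; rewrite !le_min cg ch//=.
rewrite andbT; apply: inf_oo_ge => //.
by case: (ltgtP (time g) (time h)) gh.
Qed.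

(** The infimum in [graph_inf] only sees [w] at interior times; right continuity and left limits
    extend the bound to the points on jumps, including those at the two end times. *)
Lemma graph_inf_le_path g1 g2 g3 : (g1 <= g2)%O -> (g2 <= g3)%O ->
  graph_inf g1 g3 <= graph_path g2.
Proof.
move=> l12 l23; have t12 := le_time l12; have t23 := le_time l23.
have [i1 i3] := graph_inf_le g1 g3.
have b1 := time_bounds g1; have b3 := time_bounds g3.
move: l12 l23; rewrite !le_graphE /le_graph.
have [t13|t13] := eqVneq (time g1) (time g3).
  have e12 : time g1 = time g2 by apply/eqP; rewrite eq_le t12 t13.
  rewrite -e12 ltxx eqxx/= -t13 ltxx eqxx/= /between !ge_min !le_max; lra.
have lt13 : time g1 < time g3 by rewrite lt_neqAle t13 (le_trans t12).
have jE : graph_inf g1 g3 <= inf_oo w (time g1) (time g3).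
  by rewrite /graph_inf (negbTE t13) (min_l (ltW lt13)) (max_r (ltW lt13)) ge_min lexx.
have b2 := (graphP g2).2.
have [e12|n12] := eqVneq (time g1) (time g2).
  have : graph_inf g1 g3 <= w (time g2).
    by apply: (le_trans jE); rewrite -e12; apply: inf_oo_le_left => //; lra.
  move: b2; rewrite -e12 ltxx /= (negbTE t13) orbF /between !ge_min !le_max.
  by move=> *; lra.
have l12 : time g1 < time g2 by rewrite lt_neqAle n12.
have : graph_inf g1 g3 <= left_lim w (time g2).
  apply: (le_trans jE); apply: (@le_trans _ _ (inf_oo w (time g1) (time g2))).
    by apply: inf_oo_subset => //; lra.
  by apply: inf_oo_le_right => //; lra.
have [e23|n23] := eqVneq (time g2) (time g3).
  by move: b2; rewrite e23 ltxx/= /between !ge_min !le_max => *; lra.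
have l23 : time g2 < time g3 by rewrite lt_neqAle n23.
have : graph_inf g1 g3 <= w (time g2).
  by apply: (le_trans jE); apply: inf_oo_le => //; lra.
by move: b2; rewrite /between !ge_min !le_max => *; lra.
Qed.

Lemma graph_inf_mono g1 g2 g3 : (g1 <= g2)%O -> (g2 <= g3)%O ->
  graph_inf g1 g3 <= graph_inf g1 g2.
Proof.
move=> l12 l23; have t12 := le_time l12; have t23 := le_time l23.
apply: graph_inf_ge.
- by have [] := graph_inf_le g1 g3.
- exact: graph_inf_le_path.
- rewrite (min_l t12) (max_r t12) => u /andP[u1 u2]; apply: graph_inf_lt => //.
  by rewrite (min_l (le_trans t12 t23)) (max_r (le_trans t12 t23)); lra.
Qed.

(** The lower end of the jump at [t]. This function is lower semicontinuous even where [w] is not,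
    so that first and last times below a level exist. *)
Definition low t := Num.min (w t) (left_lim w t).

Lemma low_path g : low (time g) <= graph_path g.
Proof. by have := (graphP g).2; rewrite /low /between minC => /andP[]. Qed.

Lemma closed_low c : closed [set t | t \in `[0, 1] /\ low t <= c].
Proof.
suff h (t : R) : closure [set t | t \in `[0, 1] /\ low t <= c] t ->
    t \in `[0, 1] /\ low t <= c by move=> t /h.
move=> ct; have t01 : t \in `[0, 1].
  have : closure (`[0, 1] : set R) t.
    by apply: closure_subset ct => u /= [].
  by rewrite -(proj1 (closure_id _) _)//; exact: itv_closed.
split => //; rewrite leNgt; apply/negP => ltc.
have := t01; rewrite in_itv/= => /andP[t0 t1].
have [d1 d10 h1] : exists2 d, 0 < d &
    forall u, t < u < t + d -> u \in `[0, 1] -> c < low u.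
  have [t1E|] := eqVneq t 1.
    by exists 1 => // u; rewrite in_itv/=; lra.
  move=> tn1; have {}t01 : 0 <= t < 1 by rewrite t0 lt_neqAle tn1.
  (* Points within half of the gap of [w t], which is at least [low t], stay above [c]. *)
  pose e := (low t - c) / 2; have e0 : 0 < e by rewrite divr_gt0 ?subr_gt0.
  have [d d0 hd] := near_right_path t01 e0; exists d => // u ut u01.
  have := hd (graph_low w u01); rewrite /time/= => /(_ ut).
  rewrite /graph_path/= -/(low u).
  have : low t <= w t by rewrite /low ge_min lexx.
  by rewrite ler_distl /e; lra.
have [d2 d20 h2] : exists2 d, 0 < d &
    forall u, t - d < u < t -> u \in `[0, 1] -> c < low u.
  have [t0E|] := eqVneq t 0.
    by exists 1 => // u; rewrite in_itv/=; lra.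
  move=> tn0; have {}t01 : 0 < t <= 1 by rewrite t1 lt_neqAle eq_sym tn0 t0.
  pose e := (low t - c) / 2; have e0 : 0 < e by rewrite divr_gt0 ?subr_gt0.
  have [d d0 hd] := near_left_path t01 e0; exists d => // u ut u01.
  have := hd (graph_low w u01); rewrite /time/= => /(_ ut).
  rewrite /graph_path/= -/(low u).
  have : low t <= left_lim w t by rewrite /low ge_min lexx orbT.
  by rewrite ler_distl /e; lra.
have d0 : 0 < Num.min d1 d2 by rewrite lt_min d10.
have [u [[u01 uc] /= tu]] := ct _ (nbhsx_ballx t _ d0).
move: tu; rewrite /ball/= lt_min !ltr_distlC => tu.
have [ut|tu'|utE] := ltgtP u t.
- by have := h2 u; rewrite u01 ut; move=> /(_ _ isT); lra.
- by have := h1 u; rewrite u01 tu'; move=> /(_ _ isT); lra.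
- by move: uc; rewrite utE; lra.
Qed.

(** The sublevel set in the segment is compact, so it has a last time; [low_min] is the mirror image
    with the first time. *)
Lemma low_max c s t : 0 <= s -> s <= t -> t <= 1 -> low s <= c ->
  exists2 u, s <= u <= t /\ low u <= c & forall v, u < v <= t -> c < low v.
Proof.
move=> s0 st t1 sc; pose K : set R := `[s, t] `&` [set u | u \in `[0, 1] /\ low u <= c].
have K0 : K !=set0.
  by exists s; split; rewrite /= in_itv/= ?lexx ?st// s0 (le_trans st t1).
have cK : compact K by apply: compact_closedI; [exact: segment_compact|exact: closed_low].
have [u uK hu] := @compact_EVT_max R R id K K0 cK
  (continuous_subspaceT (fun x => @cvg_id _ (nbhs x))).
move: uK; rewrite inE => -[] /=; rewrite in_itv/= => ust [u01 uc].
exists u => // v /andP[uv vt]; rewrite ltNge; apply/negP => vc.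
have := hu v; rewrite inE => /(_ _); rewrite leNgt uv => h.
suff : K v by move/h.
by split; rewrite /= in_itv/=; [lra|split => //; lra].
Qed.

Lemma low_min c s t : 0 <= s -> s <= t -> t <= 1 -> low t <= c ->
  exists2 u, s <= u <= t /\ low u <= c & forall v, s <= v < u -> c < low v.
Proof.
move=> s0 st t1 sc; pose K : set R := `[s, t] `&` [set u | u \in `[0, 1] /\ low u <= c].
have K0 : K !=set0.
  by exists t; split; rewrite /= in_itv/= ?lexx ?st// t1 (le_trans s0 st).
have cK : compact K by apply: compact_closedI; [exact: segment_compact|exact: closed_low].
have [u uK hu] := @compact_EVT_min R R id K K0 cK
  (continuous_subspaceT (fun x => @cvg_id _ (nbhs x))).
move: uK; rewrite inE => -[] /=; rewrite in_itv/= => ust [u01 uc].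
exists u => // v /andP[uv vt]; rewrite ltNge; apply/negP => vc.
have := hu v; rewrite inE => /(_ _); rewrite leNgt vt => h.
suff : K v by move/h.
by split; rewrite /= in_itv/=; [lra|split => //; lra].
Qed.

End graph_local.

(** * Distances along the graph and compactness of the tree *)

Section graph_tree.
Context {R : realType} (w : R -> R) (cw : cadlag w).
Implicit Types (g h k : graph w) (t u c e : R).

Lemma graph_inf_near g h e : (g <= h)%O -> 0 < e ->
  exists k, [/\ (g <= k)%O, (k <= h)%O & graph_path k <= graph_inf g h + e].
Proof.
move=> gh e0; apply: contrapT => /forallNP hk.
have {}hk k : (g <= k)%O -> (k <= h)%O -> graph_inf g h + e <= graph_path k.
  by move=> gk kh; rewrite leNgt; apply/negP => /ltW kI; apply: (hk k).
suff : graph_inf g h + e <= graph_inf g h by lra.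
have tgh := le_time gh; apply: graph_inf_ge; [exact: hk|exact: hk|].
rewrite (min_l tgh) (max_r tgh) => u /andP[gu uh].
have u01 : u \in `[0, 1].
  by have := time_bounds g; have := time_bounds h; rewrite in_itv/=; lra.
rewrite -(path_graph_pt w u01); apply: hk; apply: lt_time_le;
  by rewrite time_graph_pt.
Qed.

(** The distance is the sum of the two descents to the infimum, so one of them is at least half of
    it. A point whose level is within a sixth of the distance from the infimum leaves an increment
    of at least a third. *)
Lemma graph_dist_gap g h : (g <= h)%O -> exists l r,
  [/\ (g <= l)%O, (l <= r)%O, (r <= h)%O &
      graph_dist g h <= 3 * `|graph_path r - graph_path l|].
Proof.
move=> gh; have := graph_dist_ge0 g h; rewrite le_eqVlt => /predU1P[<-|d0].
  by exists g, g; split => //; rewrite mulr_ge0.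
have e0 : 0 < graph_dist g h / 6 by rewrite divr_gt0.
have [k [gk kh kI]] := graph_inf_near gh e0.
have dE := graph_distE g h; have [gI hI] := graph_inf_le g h.
case: (leP (graph_path g) (graph_path h)) => pgh.
  exists k, h; split => //; have := ler_norm (graph_path h - graph_path k).
  by lra.
exists g, k; split => //; have := ler_norm (graph_path g - graph_path k).
by rewrite distrC; lra.
Qed.

Lemma graph_dist_small g h c e : `|graph_path g - c| <= e -> `|graph_path h - c| <= e ->
  (forall u, Num.min (time g) (time h) < u < Num.max (time g) (time h) ->
    `|w u - c| <= e) ->
  graph_dist g h <= 4 * e.
Proof.
rewrite !ler_distl => /andP[g1 g2] /andP[h1 h2] hu; rewrite graph_distE.
suff : c - e <= graph_inf g h by lra.
by apply: graph_inf_ge => // u /hu; rewrite ler_distl => /andP[].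
Qed.

(** The image of an ultrafilter converges to any of its cluster points, and compactness supplies
    one. *)
Lemma ultra_cvg_segment (X : Type) (F : set_system X) (f : X -> R) (a b : R) :
  UltraFilter F -> F [set x | a <= f x <= b] ->
  exists2 c, a <= c <= b & f @ F --> c.
Proof.
move=> UF Fab; have FF : ProperFilter F by exact: ultra_proper.
have [c [/= cab cc]] : `[a, b] `&` cluster (f @ F) !=set0.
  apply: segment_compact; apply: (@filterS _ F _ _ _ _ Fab) => x xab; rewrite /=.
  by rewrite in_itv/=.
exists c; first by move: cab; rewrite in_itv.
move=> V Vc; have [//|FV] := in_ultra_setVsetC (f @^-1` V) UF.
have [x [/= nVx Vx]] := cc (~` V) V (FV : (f @ F) (~` V)) Vc.
by case: (nVx Vx).
Qed.

Lemma tree_mdist_pi g h : mdist (\pi_(tree cw) g) (\pi_(tree cw) h) = graph_dist g h.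
Proof. exact: tree_dist_pi. Qed.

Lemma tree_cvg (F : set_system (tree cw)) (FF : Filter F) g :
  (forall e, 0 < e -> \forall x \near F, graph_dist g (repr x) <= 4 * e) ->
  F --> \pi_(tree cw) g.
Proof.
move=> h; apply/metricType_numDomainType.fcvgrPdist_lt => e e0.
have e5 : 0 < e / 5 by rewrite divr_gt0.
apply: filterS (h _ e5) => x /= hx.
by rewrite -[x in mdist _ x]reprK tree_mdist_pi; lra.
Qed.

(* Along an ultrafilter the times converge to some t, and stay on one side of t
   or equal to t: the limit is (t, left_lim w t), (t, w t) or a point above t. *)
Lemma tree_compact : compact [set: tree cw].
Proof.
rewrite compact_ultra => F UF _; have FF : ProperFilter F by exact: ultra_proper.
have [t t01 Ft] := @ultra_cvg_segment _ F (fun x => time (repr x)) 0 1 UF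
  (filterS (fun x _ => time_bounds (repr x)) filterT).
suff [g hg] : exists g, F --> \pi_(tree cw) g by exists (\pi g).
have t01' : t \in `[0, 1] by rewrite in_itv.
have near_t d : 0 < d -> \forall x \near F, t - d < time (repr x) < t + d.
  move=> d0; have /= := @cvgr_dist_lt _ _ _ _ _ _ _ Ft _ d0.
  move=> /(_ _)/filterS; apply => x.
  by rewrite ltr_distlC.
have [Flt|] := in_ultra_setVsetC [set x : tree cw | time (repr x) < t] UF.
  have t0 : 0 < t <= 1.
    have [x /= xt] := @filter_ex _ _ FF _ Flt; have := time_bounds (repr x); lra.
  have gl : in_graph w (t, left_lim w t) by rewrite /in_graph/= t01' betweenl.
  exists (Graph gl); apply: tree_cvg => e e0.
  have [d d0 hd] := near_left_path cw t0 e0.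
  apply: filterS2 Flt (near_t d d0) => x /= xt /andP[xd _].
  apply: (@graph_dist_small _ _ (left_lim w t)).
  - by rewrite /graph_path/= subrr normr0 ltW.
  - by apply: hd; rewrite xt xd.
  - rewrite /time/= -/(time (repr x)) (min_r (ltW xt)) (max_l (ltW xt)) => u /andP[xu ut].
    have u01 : u \in `[0, 1] by have := time_bounds (repr x); rewrite in_itv/=; lra.
    by rewrite -(path_graph_pt w u01); apply: hd; rewrite time_graph_pt//; lra.
move=> Fge.
have [Fgt|Fle] := in_ultra_setVsetC [set x : tree cw | t < time (repr x)] UF.
  have t0 : 0 <= t < 1.
    have [x /= xt] := @filter_ex _ _ FF _ Fgt; have := time_bounds (repr x); lra.
  exists (graph_pt w t); apply: tree_cvg => e e0.
  have [d d0 hd] := near_right_path cw t0 e0.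
  apply: filterS2 Fgt (near_t d d0) => x /= xt /andP[_ xd].
  apply: (@graph_dist_small _ _ (w t)).
  - by rewrite path_graph_pt// subrr normr0 ltW.
  - by apply: hd; rewrite xt xd.
  - rewrite time_graph_pt// (min_l (ltW xt)) (max_r (ltW xt)) => u /andP[xu ut].
    have u01 : u \in `[0, 1] by have := time_bounds (repr x); rewrite in_itv/=; lra.
    by rewrite -(path_graph_pt w u01); apply: hd; rewrite time_graph_pt//; lra.
have Feq : F [set x | time (repr x) = t].
  apply: filterS2 Fge Fle => x /= /negP; rewrite -leNgt => h1 /negP; rewrite -leNgt => h2.
  by apply/eqP; rewrite eq_le h1 h2.
have Fb : F [set x : tree cw | between (left_lim w t) (w t) (graph_path (repr x))].
  by apply: filterS Feq => x /= xt; have := (graphP (repr x)).2; rewrite xt.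
have [c cab Fc] := ultra_cvg_segment UF Fb.
have gc : in_graph w (t, c) by rewrite /in_graph/= t01'.
exists (Graph gc); apply: tree_cvg => e e0.
have /= := @cvgr_dist_le _ _ _ _ _ _ _ Fc _ e0.
move=> /(_ _)/filterS2; apply; last exact: Feq.
move=> x xc /= xt; apply: (@graph_dist_small _ _ c).
- by rewrite /graph_path/= subrr normr0 ltW.
- by rewrite distrC.
- by rewrite /time/= -/(time (repr x)) xt minxx maxxx => u /andP[]; lra.
Qed.

End graph_tree.

(** * Levels and branching in the tree *)

(* The Gromov product: in the tree rooted at [o], the level at which the
   branches leading to [x] and [y] separate. *)
Definition gprod {R : realType} {T : metricType R} (o x y : T) : R :=
  (mdist o x + mdist o y - mdist x y) / 2.

Section tree_root.
Context {R : realType} (w : R -> R) (cw : cadlag w).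
Implicit Types (g h k : graph w) (t u c e : R).

Lemma inf_le_low t : t \in `[0, 1] -> inf [set w t | t in `[0, 1]] <= low w t.
Proof.
move=> t01; have inf_le u : u \in `[0, 1] -> inf [set w t | t in `[0, 1]] <= w u.
  move=> u01; apply: ge_inf; last by exists u.
  have [m hm] := cadlag_lbound cw; exists m => _ [v /= v01 <-]; exact: hm.
rewrite /low le_min inf_le//=.
have := t01; rewrite in_itv/= => /andP[]; rewrite le_eqVlt => /predU1P[<- _|t0 t1].
  by rewrite left_lim0 inf_le// in_itv/= lexx ler01.
have t01' : 0 < t <= 1 by rewrite t0.
apply: (cvgr_to_ge (cvg_left_cadlag cw t01')); near=> u; apply: inf_le.
rewrite in_itv/=; apply/andP; split; last first.
  by rewrite (le_trans _ t1)//; near: u; exact: nbhs_left_le.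
by near: u; exact: nbhs_left_ge.
Unshelve. all: by end_near. Qed.

Context (U : R) (U01 : U \in `[0, 1]).
Hypothesis U_min : low w U = inf [set w t | t in `[0, 1]].
Local Notation O := (\pi_(tree cw) (graph_low w U01)).

Lemma low_min_path g : low w U <= graph_path g.
Proof. by rewrite U_min; apply: le_trans (inf_le_low (time01 g)) (low_path g). Qed.

Lemma graph_inf_root g : graph_inf (graph_low w U01) g = low w U.
Proof.
have [h _] := graph_inf_le (graph_low w U01) g.
apply/eqP; rewrite eq_le h/=; apply: graph_inf_ge => //; first exact: low_min_path.
move=> u; have := time_bounds g; have := time_bounds (graph_low w U01).
case: (leP (time (graph_low w U01)) (time g)) => _ b1 b2 ub;
  (have u01 : u \in `[0, 1] by rewrite in_itv/=; lra);
  by rewrite U_min; apply: le_trans (inf_le_low u01) _; rewrite /low ge_min lexx.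
Qed.

Lemma level_pi g : mdist O (\pi_(tree cw) g) = graph_path g - low w U.
Proof.
rewrite tree_mdist_pi graph_distE graph_inf_root /graph_path/= -/(graph_path g).
by rewrite -/(low w U); ring.
Qed.

(** This turns [graph_inf_ultra] into the branching inequality [tree_ultra]. *)
Lemma gprod_pi g h :
  gprod O (\pi_(tree cw) g) (\pi_(tree cw) h) = graph_inf g h - low w U.
Proof. by rewrite /gprod !level_pi tree_mdist_pi graph_distE; field. Qed.

Lemma tree_ultra (x y z : tree cw) :
  Num.min (gprod O x y) (gprod O y z) <= gprod O x z.
Proof.
rewrite -[x]reprK -[y]reprK -[z]reprK !gprod_pi.
by have := graph_inf_ultra (repr x) (repr y) (repr z) cw; rewrite !ge_min; lra.
Qed.

(* The point h is at the time closest to that of g, on the side of U, where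
   [low w] is at most c. *)
Lemma graph_down g c : low w U <= c <= graph_path g ->
  exists h, graph_path h = c /\ graph_inf h g = c.
Proof.
move=> /andP[Uc cg]; have tg01 := time01 g; set t := time g in tg01.
have bg := (graphP g).2; have := tg01; rewrite in_itv/= => /andP[t0 t1].
have := U01; rewrite in_itv/= => /andP[U0 U1].
have mk h : graph_path h = c ->
    (forall u, Num.min (time h) t < u < Num.max (time h) t -> c <= w u) ->
    exists h, graph_path h = c /\ graph_inf h g = c.
  move=> hc hu; exists h; split => //; apply/eqP; rewrite eq_le.
  have [+ _] := graph_inf_le h g; rewrite hc => -> /=.
  by apply: graph_inf_ge => //; rewrite hc.
have [tc|ct] := leP (low w t) c.
  have hin : in_graph w (t, c).
    rewrite /in_graph/= tg01; move: bg; rewrite /between minC -/(low w t) tc/=.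
    by move=> /andP[_]; apply: le_trans.
  apply: (mk (Graph hin)) => // u; rewrite /time/= minxx maxxx => /andP[]; lra.
have lw v : low w v <= w v by rewrite /low ge_min lexx.
have [Ut|tU|tUE] := ltgtP U t; last by move: ct; rewrite -tUE; lra.
  have [u [/andP[Uu ut] uc] hu] := low_max cw U0 (ltW Ut) t1 Uc.
  have {}ut : u < t.
    by rewrite lt_neqAle ut andbT; apply/eqP => utE; move: ct; rewrite -utE; lra.
  (* The path is above [c] just after [u]; by right continuity the jump at [u] crosses the level
     [c]. *)
  have cw_u : c <= w u.
    have u01 : 0 <= u < 1 by lra.
    apply: (cvgr_to_ge (cvg_right_cadlag cw u01)); near=> v.
    apply: le_trans (lw v); apply/ltW/hu; apply/andP; split.
      by near: v; exact: nbhs_right_gt.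
    by near: v; exact: nbhs_right_le.
  have hin : in_graph w (u, c).
    rewrite /in_graph/= in_itv/=; apply/andP; split; first lra.
    by rewrite /between minC -/(low w u) uc le_max cw_u orbT.
  apply: (mk (Graph hin)) => // v; rewrite /time/= (min_l (ltW ut)) (max_r (ltW ut)).
  by move=> /andP[uv vt]; apply: le_trans (lw v); apply/ltW/hu; rewrite uv ltW.
have [u [/andP[tu uU] uc] hu] := low_min cw t0 (ltW tU) U1 Uc.
have {}tu : t < u.
  by rewrite lt_neqAle tu andbT; apply/eqP => utE; move: ct; rewrite utE; lra.
(* On this side the path is above [c] just before [u], so it is the left limit that is at least
   [c]. *)
have cw_u : c <= left_lim w u.
  have u01 : 0 < u <= 1 by lra.
  apply: (cvgr_to_ge (cvg_left_cadlag cw u01)); near=> v.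
  apply: le_trans (lw v); apply/ltW/hu; apply/andP; split.
    by near: v; exact: nbhs_left_ge.
  by near: v; exact: nbhs_left_lt.
have hin : in_graph w (u, c).
  rewrite /in_graph/= in_itv/=; apply/andP; split; first lra.
  by rewrite /between minC -/(low w u) uc le_max cw_u.
apply: (mk (Graph hin)) => // v; rewrite /time/= (min_r (ltW tu)) (max_l (ltW tu)).
by move=> /andP[uv vt]; apply: le_trans (lw v); apply/ltW/hu; rewrite vt ltW.
Unshelve. all: by end_near. Qed.

Lemma tree_down (x : tree cw) r : 0 <= r <= mdist O x ->
  exists y, mdist O y = r /\ mdist y x = mdist O x - r.
Proof.
rewrite -[x]reprK level_pi => rx.
have [|h [hp hI]] := @graph_down (repr x) (r + low w U); first lra.
exists (\pi_(tree cw) h); rewrite level_pi hp tree_mdist_pi graph_distE hI hp.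
by split; lra.
Qed.

End tree_root.

(** * Compact rooted trees *)

Section metric_continuity.
Context {R : realType} {T : metricType R}.
Implicit Types x y z : T.

Lemma mdist_lip x x' y y' : `|mdist x y - mdist x' y'| <= mdist x x' + mdist y y'.
Proof.
have h1 := metric_triangle x x' y; have h2 := metric_triangle x' y' y.
have h3 := metric_triangle x' x y'; have h4 := metric_triangle x y y'.
by rewrite ler_norml (metric_sym y' y) in h2 *; rewrite (metric_sym x' x) in h3 *; lra.
Qed.

Lemma continuous_mdist2 : continuous (fun p : T * T => mdist p.1 p.2).
Proof.
move=> p; apply/cvgrPdist_lt => e e0; have e2 : 0 < e / 2 by rewrite divr_gt0.
have h1 := metricType_numDomainType.cvgr_dist_lt
  (@cvg_fst _ _ (nbhs p.1) (nbhs p.2) _) e2.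
have h2 := metricType_numDomainType.cvgr_dist_lt
  (@cvg_snd _ _ (nbhs p.1) (nbhs p.2) _) e2.
near=> q; apply: le_lt_trans (mdist_lip _ _ _ _) _; rewrite (splitr e).
by apply: ltrD; near: q; [exact: h1|exact: h2].
Unshelve. all: by end_near. Qed.

Lemma continuous_mdist x : continuous (mdist x).
Proof.
move=> y; apply/cvgrPdist_lt => e e0.
near=> z; apply: le_lt_trans (mdist_lip _ _ _ _) _; rewrite mdistxx add0r.
near: z; exact: (metricType_numDomainType.cvgr_dist_lt (@cvg_id _ (nbhs y))).
Unshelve. all: by end_near. Qed.

Lemma closed_real_eq {X : topologicalType} (f g : X -> R) :
  continuous f -> continuous g -> closed [set p | f p = g p].
Proof.
move=> cf cg; have -> : [set p | f p = g p] = (fun p => f p - g p) @^-1` [set 0].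
  by apply/seteqP; split => x /= => [->|/eqP]; rewrite ?subrr// subr_eq0 => /eqP.
apply: preimage_closed; last exact: closed_eq.
by move=> x _; apply: cvgB; [exact: cf|exact: cg].
Qed.

Lemma closed_real_ge {X : topologicalType} (f : X -> R) a :
  continuous f -> closed [set p | a <= f p].
Proof.
move=> cf; apply: (@preimage_closed _ _ f [set y | a <= y]); last exact: closed_ge.
by move=> x _; exact: cf.
Qed.

End metric_continuity.

(** * Order, arcs, heights and leaves of a rooted tree *)

Section rooted_tree.
Context {R : realType} {T : metricType R} (O : T).
Implicit Types (x y z : T) (r a : R).

(** Membership in the arc from the root to [x], encoded as equality in the triangle inequality;
    [aboveP] gives the link with [above]. *)
Definition below y x : Prop := mdist O y + mdist y x = mdist O x.

Lemma gprod_le x y : gprod O x y <= mdist O x /\ gprod O x y <= mdist O y.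
Proof.
have h1 := metric_triangle O x y; have h2 := metric_triangle O y x.
by rewrite (metric_sym y x) in h2; rewrite /gprod; lra.
Qed.

Lemma gprodC x y : gprod O x y = gprod O y x.
Proof. by rewrite /gprod (metric_sym x y) (addrC (mdist O x)). Qed.

Lemma belowE y x : below y x <-> gprod O y x = mdist O y.
Proof. by rewrite /below /gprod; split; lra. Qed.

Lemma below_refl x : below x x.
Proof. by rewrite /below mdistxx addr0. Qed.

Lemma below_root x : below O x.
Proof. by rewrite /below mdistxx add0r. Qed.

Lemma below_le y x : below y x -> mdist O y <= mdist O x.
Proof. by rewrite /below => <-; rewrite lerDl mdist_ge0. Qed.

Lemma below_trans z y x : below z y -> below y x -> below z x.
Proof.
rewrite /below => h1 h2; apply/eqP; rewrite eq_le.
have := metric_triangle O z x; have := metric_triangle z y x; lra.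
Qed.

Lemma closed_below x : closed [set y | below x y].
Proof.
apply: closed_real_eq; last exact: continuous_mdist.
by move=> y; apply: cvgD; [exact: cvg_cst|exact: continuous_mdist].
Qed.

Hypothesis ultra : forall x y z, Num.min (gprod O x y) (gprod O y z) <= gprod O x z.
Hypothesis down : forall x r, 0 <= r <= mdist O x ->
  exists y, mdist O y = r /\ mdist y x = mdist O x - r.

(** By the branching inequality through [x], the two points separate no lower than the lower of
    their levels. *)
Lemma mdist_below y1 y2 x : below y1 x -> below y2 x ->
  mdist y1 y2 = `|mdist O y1 - mdist O y2|.
Proof.
rewrite !belowE => h1 h2; have := ultra y1 x y2.
rewrite h1 gprodC h2; have [g1 g2] := gprod_le y1 y2.
move: g1 g2; rewrite /gprod ge_min => g1 g2.
by case: (ler0P (mdist O y1 - mdist O y2)); lra.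
Qed.

Lemma below_level y1 y2 x : below y1 x -> below y2 x -> mdist O y1 <= mdist O y2 ->
  below y1 y2.
Proof.
move=> h1 h2 h; rewrite /below (mdist_below h1 h2) ler0_norm ?subr_le0//; lra.
Qed.

Lemma arcP y x z : below y x -> Defs.arc y x z <-> below y z /\ below z x.
Proof.
move=> yx; split.
  move=> [f [f0 f1 fi [s /= sI <-]]].
  have d0 : 0 \in `[0, mdist y x] by rewrite in_itv/= lexx mdist_ge0.
  have d1 : mdist y x \in `[0, mdist y x] by rewrite in_itv/= lexx mdist_ge0.
  have := fi _ _ d0 sI; have := fi _ _ sI d1; rewrite f0 f1 !(distrC s).
  move: sI; rewrite in_itv/= => /andP[s0 s1].
  rewrite sub0r normrN !ger0_norm ?subr_ge0// => e1 e2.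
  rewrite /below in yx *.
  have := metric_triangle O y (f s); have := metric_triangle O (f s) x; lra.
move=> [yz zx]; pose P r u := below u x /\ mdist O u = r.
have exP r : 0 <= r <= mdist O x -> exists u, P r u.
  by move=> /down[u [u1 u2]]; exists u; split => //; rewrite /below; lra.
(* On the segment a point at the required level exists, so [xget] does not resort to its default
   there. *)
pose f s := xget x (P (mdist O y + s)).
have ly := below_le yx; have ldx : mdist y x = mdist O x - mdist O y by rewrite -yx; ring.
have O0 := mdist_ge0 O y.
have fP s : s \in `[0, mdist y x] -> P (mdist O y + s) (f s).
  rewrite in_itv/= => sI; apply: (@xgetPex _ x (P (mdist O y + s))); apply: exP; lra.
have fE s u : s \in `[0, mdist y x] -> P (mdist O y + s) u -> f s = u.
  move=> /fP[h1 h2] [h3 h4]; apply: mdist_positivity.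
  by rewrite (mdist_below h1 h3) h2 h4 subrr normr0.
exists f; split.
- by apply: fE; rewrite ?in_itv/= ?lexx ?mdist_ge0//; split => //; rewrite addr0.
- apply: fE; rewrite ?in_itv/= ?lexx ?mdist_ge0//; split; first exact: below_refl.
  by rewrite ldx; ring.
- move=> s t /fP[h1 h2] /fP[h3 h4]; rewrite (mdist_below h1 h3) h2 h4.
  by congr `|_|; ring.
- have lz := below_le yz; have lx := below_le zx.
  exists (mdist O z - mdist O y); first by rewrite /= in_itv/= ldx; lra.
  apply: fE; first by rewrite in_itv/= ldx; lra.
  by split => //; ring.
Qed.

Lemma aboveP x y : above O x y <-> below y x.
Proof.
rewrite /above (arcP _ (below_root x)); split => [[]//|h]; split => //.
exact: below_root.
Qed.

(** The arc is the locus of equality in the triangle inequality between its end points. *)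
Lemma closed_arc y x : below y x -> closed (Defs.arc y x).
Proof.
move=> yx; have -> : Defs.arc y x = [set z | mdist y z + mdist x z = mdist y x].
  apply/seteqP; split => z /=; rewrite (arcP _ yx) /below (metric_sym x z).
    by rewrite /below in yx; lra.
  rewrite /below in yx; have := metric_triangle O y z; have := metric_triangle O z x; lra.
apply: closed_real_eq; last by move=> z; exact: cvg_cst.
by move=> z; apply: cvgD; exact: continuous_mdist.
Qed.

Hypothesis cT : compact [set: T].

(** The points above [x] form a compact set, on which the distance to [x] is continuous. *)
Lemma height_attained x : exists y, [/\ below x y, height O x = mdist x y &
  forall z, below x z -> mdist x z <= mdist x y].
Proof.
have cA : compact [set y | below x y].
  by rewrite -[X in compact X]setTI; apply: compact_closedI => //; exact: closed_below.
have [|y yA hy] := compact_EVT_max _ cA (continuous_subspaceT (@continuous_mdist _ _ x)).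
  by exists x; exact: below_refl.
rewrite inE/= in yA; have {}hy z : below x z -> mdist x z <= mdist x y.
  by move=> xz; apply: hy; rewrite inE.
exists y; split => //; rewrite /height; apply/eqP; rewrite eq_le; apply/andP; split.
  apply: ge_sup; first by exists (mdist x y), y => //; apply/aboveP.
  by move=> _ [z /aboveP xz <-]; exact: hy.
apply: ub_le_sup; last by exists y => //; apply/aboveP.
by exists (mdist x y) => _ [z /aboveP xz <-]; exact: hy.
Qed.

Lemma height_ge x y : below x y -> mdist x y <= height O x.
Proof. by move=> xy; have [z [xz -> hz]] := height_attained x; exact: hz. Qed.

Lemma height_ge0 x : 0 <= height O x.
Proof. by rewrite (le_trans _ (height_ge (below_refl x)))// mdist_ge0. Qed.

Lemma height_below x y : below x y -> mdist x y + height O y <= height O x.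
Proof.
move=> xy; have [z [yz -> _]] := height_attained y.
have xz := below_trans xy yz; apply: le_trans (height_ge xz).
by move: xy yz xz; rewrite /below; lra.
Qed.

(* [trim O a] is the projection of a compact subset of T * T. *)
Lemma closed_trim a : closed (trim O a).
Proof.
pose K := [set p : T * T | below p.1 p.2] `&` [set p | a <= mdist p.1 p.2].
have -> : trim O a = fst @` K.
  apply/seteqP; split => [x /= xa|x [p [/= p1 p2] <-]].
    have [y [xy hE _]] := height_attained x; exists (x, y) => //.
    by split => //=; rewrite -hE.
  by apply: le_trans p2 _; exact: height_ge.
have cl : forall (f : T * T -> T), continuous f -> continuous (fun p => mdist O (f p)).
  by move=> f cf p; apply: continuous_comp; [exact: cf|exact: continuous_mdist].
have cfst : continuous (@fst T T) by move=> p; exact: cvg_fst.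
have csnd : continuous (@snd T T) by move=> p; exact: cvg_snd.
apply: compact_closed; first exact: metric_hausdorff.
apply: continuous_compact; first exact: continuous_subspaceT.
apply: (@subclosed_compact _ _ (setT `*` setT)) => //; last exact: compact_setX.
apply: closedI.
  apply: closed_real_eq; last exact: cl.
  by move=> p; apply: cvgD; [exact: cl|exact: continuous_mdist2].
by apply: closed_real_ge; exact: continuous_mdist2.
Qed.

(** Take a point of maximal level in the compact set of points of the trimmed tree above [x]. *)
Lemma leaf_above a x : trim O a x -> exists2 l, leaves O (trim O a) l & below x l.
Proof.
move=> xa; have cA : compact (trim O a `&` [set y | below x y]).
  rewrite -[X in compact X]setTI; apply: compact_closedI => //.
  by apply: closedI; [exact: closed_trim|exact: closed_below].
have [|l] := compact_EVT_max _ cA (continuous_subspaceT (@continuous_mdist _ _ O)).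
  by exists x; split => //; exact: below_refl.
rewrite inE => -[la xl] hl; exists l => //; split => // y ya /aboveP ly.
have := hl y; rewrite inE => /(_ (conj ya (below_trans xl ly))) h.
apply: esym; apply: mdist_positivity; have := mdist_ge0 l y.
by move: ly; rewrite /below; lra.
Qed.

(** Distinct leaves are incomparable, so their branches separate strictly below both. Points above
    them separate no higher, and the way from one to the other passes through both leaves. *)
Lemma trim_leaves_sep a x y x' y' : leaves O (trim O a) x -> leaves O (trim O a) y ->
  x <> y -> below x x' -> below y y' -> mdist x x' + mdist y y' <= mdist x' y'.
Proof.
move=> [xa xl] [ya yl] xy xx' yy'.
have h1 : gprod O x y < mdist O x.
  rewrite lt_neqAle (gprod_le x y).1 andbT; apply/eqP => /belowE h.
  by apply: xy; symmetry; apply: xl => //; apply/aboveP.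
have h2 : gprod O x y < mdist O y.
  rewrite lt_neqAle (gprod_le x y).2 andbT; apply/eqP; rewrite gprodC => /belowE h.
  by apply: xy; apply: yl => //; apply/aboveP.
have e1 := ultra x x' y; have e2 := ultra x' y' y.
move: (xx') (yy'); rewrite !belowE => f1 f2; move: e1 e2; rewrite f1 (gprodC y' y) f2.
rewrite !ge_min => /orP[|e1]; first lra.
move=> /orP[|]; last lra.
by rewrite /below in xx' yy'; rewrite /gprod in h1 h2 e1 *; lra.
Qed.

End rooted_tree.

(** * Covering numbers *)

Section covering.
Context {R : realType} {T : metricType R}.
Implicit Types (x y : T) (a : R).

Definition is_cover a (s : seq T) : Prop := forall y, exists2 x, x \in s & ball x a y.

(** Points at distance at least 2a never share an open ball of radius [a], so choosing a centre for
    each is injective. *)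
Lemma cover_separated {I : eqType} (l : seq I) (pt : I -> T) (s : seq T) a :
  is_cover a s -> uniq l ->
  {in l &, forall i j, i != j -> 2 * a <= mdist (pt i) (pt j)} ->
  (size l <= size s)%N.
Proof.
move=> cs ul sep.
have [f fP] : {f : I -> T & forall i, f i \in s /\ mdist (f i) (pt i) < a}.
  apply: (@choice _ _ (fun i x => x \in s /\ mdist x (pt i) < a)) => i.
  have [x xs] := cs (pt i).
  by rewrite ballEmdist => xi; exists x.
rewrite -(size_map f); apply: uniq_leq_size; last first.
  by move=> _ /mapP[i _ ->]; exact: (fP i).1.
rewrite map_inj_in_uniq// => i j il jl fij; apply/eqP/negPn/negP => ij.
have := sep i j il jl ij; have := metric_triangle (pt i) (f i) (pt j).
have := (fP i).2; have := (fP j).2; rewrite -fij (metric_sym (pt i) (f i)); lra.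
Qed.

Lemma covering_number_ge a (b : \bar R) :
  (forall s, is_cover a s -> (b <= (size s)%:R%:E)%E) ->
  (b <= covering_number (T := T) a)%E.
Proof. by move=> h; apply: le_ereal_inf_tmp => _ [s /= cs <-]; exact: h. Qed.

(** A separated family that does not cover is extended by an uncovered point; without a covering by
    at most [N] balls, separated families of every size would arise. *)
Lemma covering_number_le a (N : nat) : 0 < a ->
  (forall s : seq T, uniq s -> {in s &, forall x y, x != y -> a <= mdist x y} ->
    (size s <= N)%N) ->
  (covering_number (T := T) a <= N%:R%:E)%E.
Proof.
move=> a0 hN; rewrite leNgt; apply/negP => hc.
suff H n : exists s : seq T, [/\ uniq s, size s = n &
    {in s &, forall x y, x != y -> a <= mdist x y}].
  by have [s [us sz sep]] := H N.+1; have := hN s us sep; rewrite sz ltnn.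
elim: n => [|n [s [us sz sep]]]; first by exists [::].
have [y hy] : exists y, forall x, x \in s -> a <= mdist x y.
  apply: contrapT => /forallNP h; move: hc; apply/negP; rewrite -leNgt.
  apply: le_trans (_ : (size s)%:R%:E <= _)%E; last by rewrite lee_fin ler_nat hN.
  apply: ereal_inf_lbound; exists s => //= y; apply: contrapT => hy.
  apply: (h y) => x xs; rewrite leNgt; apply/negP => xy; apply: hy.
  by exists x => //; rewrite ballEmdist.
exists (y :: s); split => /=; last first.
- move=> u v; rewrite !in_cons => /predU1P[->|us'] /predU1P[->|vs].
  + by rewrite eqxx.
  + by move=> _; rewrite metric_sym; exact: hy.
  + by move=> _; exact: hy.
  + exact: sep.
- by rewrite sz.
- rewrite us andbT; apply/negP => /hy; rewrite mdistxx leNgt a0//.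
Qed.

End covering.

(** * Lower bounds for covering numbers by leaves and by levels *)

Section rooted_covering.
Context {R : realType} {T : metricType R} (O : T).
Implicit Types (x y z : T) (r a : R).
Hypothesis ultra : forall x y z, Num.min (gprod O x y) (gprod O y z) <= gprod O x z.
Hypothesis down : forall x r, 0 <= r <= mdist O x ->
  exists y, mdist O y = r /\ mdist y x = mdist O x - r.
Hypothesis cT : compact [set: T].

Lemma nleaves_le_covering a : (nleaves O a <= covering_number (T := T) a)%E.
Proof.
apply: covering_number_ge => s cs.
have [top topP] : {top : T -> T & forall x,
    below O x (top x) /\ height O x = mdist x (top x)}.
  apply: (@choice _ _ (fun x y => below O x y /\ height O x = mdist x y)) => x.
  by have [y [xy hE _]] := height_attained ultra down cT x; exists y.
have small (l : seq T) : uniq l -> [set` l] `<=` leaves O (trim O a) ->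
    (size l <= size s)%N.
  move=> ul lL; apply: (@cover_separated _ _ _ l top s a cs ul) => x y xl yl xy.
  have xL := lL x xl; have yL := lL y yl.
  have := trim_leaves_sep ultra down xL yL (elimN eqP xy) (topP x).1 (topP y).1.
  have := xL.1; have := yL.1; rewrite /trim/= (topP x).2 (topP y).2; lra.
(* Finiteness is settled first because [counting] is infinite otherwise: an infinite set of leaves
   would contain one more than there are balls. *)
have fL : finite_set (leaves O (trim O a)).
  apply: contrapT => /(@infinite_set_fset _ _ (size s).+1)[B BL].
  by rewrite ltnNge small//; exact: finmap.fset_uniq.
rewrite /nleaves /counting asboolT// lee_fin ler_nat small//.
  exact: finmap.fset_uniq.
by move=> x /=; rewrite in_fset_set// inE.
Qed.

Lemma covering_ge_level a x : 0 < a ->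
  ((mdist O x / (2 * a))%:E <= covering_number (T := T) a)%E.
Proof.
move=> a0; apply: covering_number_ge => s cs; rewrite lee_fin.
have a2 : 0 < 2 * a by rewrite mulr_gt0.
set q := mdist O x / (2 * a); have q0 : 0 <= q by rewrite divr_ge0 ?mdist_ge0// ltW.
(* Points at the levels 0, 2a, 4a, ... up to the level of [x]; their levels alone keep them 2a
   apart, and there are more than [q] of them. *)
have [pt ptP] : {pt : nat -> T & forall k, (k <= Num.trunc q)%N ->
    mdist O (pt k) = k%:R * (2 * a)}.
  apply: (@choice _ _ (fun k y => (k <= Num.trunc q)%N ->
    mdist O y = k%:R * (2 * a))) => k.
  have [kq|_] := leqP k (Num.trunc q); last by exists O.
  have [|y [y1 _]] := @down x (k%:R * (2 * a)); last by exists y.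
  rewrite mulr_ge0 ?ler0n ?(ltW a2)//= -ler_pdivlMr// -/q.
  by rewrite -truncn_ge_nat.
have := @cover_separated _ _ _ (iota 0 (Num.trunc q).+1) pt s a cs (iota_uniq _ _).
rewrite size_iota => h; apply: (@le_trans _ _ (Num.trunc q).+1%:R).
  by apply/ltW; rewrite -truncn_le_nat.
rewrite ler_nat; apply: h => i j; rewrite !mem_iota !add0n !ltnS /= => iq jq ij.
have := mdist_lip O O (pt i) (pt j); rewrite mdistxx add0r !ptP// => h.
apply: le_trans h; rewrite -mulrBl normrM (gtr0_norm a2) ler_peMl ?(ltW a2)//.
wlog ij' : i j ij {iq jq} / (i < j)%N => [hw|].
  have [/hw->//|ji|/eqP] := ltngtP i j; last by rewrite (negbTE ij).
  by rewrite distrC hw// eq_sym.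
by rewrite distrC ger0_norm ?subr_ge0 ?ler_nat 1?ltnW// lerBrDr nat1r ler_nat.
Qed.

End rooted_covering.

(** * Upper bound for covering numbers by the variation *)

Section covering_variation.
Context {R : realType} (w : R -> R) (cw : cadlag w).

(** Between consecutive points, [graph_dist_gap] inserts two points with an increment of at least a
    / 3. *)
Lemma chain_variation p a (x : graph w) l : 0 <= a -> 0 < p -> path <=%O x l ->
  path (fun g h => a <= graph_dist g h) x l -> exists L, path <=%O x L /\
    (size l)%:R * (a / 3) `^ p <= pvar_sum (@graph_path R w) p (x :: L).
Proof.
move=> a0 p0; elim: l x => [|y l ih] x /=.
  by exists [::]; rewrite psum_pvar_sum psum1 mul0r.
move=> /andP[xy /ih{}ih] /andP[axy /ih[L [yL hL]]].
have [u [v [xu uv vy d]]] := graph_dist_gap xy.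
exists [:: u, v, y & L]; split; first by rewrite /= xu uv vy.
rewrite !psum_pvar_sum in hL *; rewrite /= !psum_cons2 -natr1 mulrDl mul1r.
have : (a / 3) `^ p <= `|graph_path v - graph_path u| `^ p.
  by apply: ge0_ler_powR; rewrite ?nnegrE ?(ltW p0)//; [apply: divr_ge0|lra].
have := powR_ge0 `|graph_path u - graph_path x| p.
have := powR_ge0 `|graph_path y - graph_path v| p; lra.
Qed.

Lemma covering_le_variation p v a : 1 <= p -> 0 < a ->
  (pvariation setT (@graph_path R w) p <= v%:E)%E ->
  (covering_number (T := tree cw) a <= (1 + v * (3 / a) `^ p)%:E)%E.
Proof.
move=> p1 a0 hv; have p0 : 0 < p by rewrite (lt_le_trans ltr01).
have a3 : 0 < a / 3 by rewrite divr_gt0.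
have v0 : 0 <= v.
  by rewrite -lee_fin; apply: le_trans hv; exact: pvariation_ge0.
have q0 : 0 <= v * (3 / a) `^ p by rewrite mulr_ge0// powR_ge0.
(* Separated families are counted by an integer, hence the integer part; the extra 1 is the first
   point of the chain. *)
apply: (@le_trans _ _ (Num.trunc (v * (3 / a) `^ p)).+1%:R%:E); last first.
  by rewrite lee_fin -natr1 addrC lerD2l -truncn_ge_nat.
apply: covering_number_le => // s us sep; case: s us sep => // x0 s us sep.
(* Representatives are sorted along the graph; distinct points of the tree have distinct ones. *)
pose l := sort <=%O (map repr (x0 :: s)).
have ul : uniq l by rewrite sort_uniq map_inj_uniq//; apply: can_inj (@reprK _ _).
have sl : sorted <=%O l by apply: sort_sorted; exact: le_total.
have szl : size l = size (x0 :: s) by rewrite size_sort size_map.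
have dl : {in l &, forall g h, g != h -> a <= graph_dist g h}.
  move=> g h; rewrite !mem_sort => /mapP[x xs ->] /mapP[y ys ->] xy.
  rewrite -(tree_mdist_pi cw) !reprK; apply: sep => //.
  by apply: contra xy => /eqP->.
rewrite -szl; case: l ul sl szl dl => // g l ul sl _ dl.
have pl : path (fun g h => a <= graph_dist g h) g l.
  have : pairwise (fun g h => a <= graph_dist g h) (g :: l).
    apply/(pairwiseP g) => i j il jl ij; apply: dl; rewrite ?mem_nth//.
    by rewrite nth_uniq// neq_ltn ij.
  by move=> /pairwise_sorted.
have [L [gL hL]] := chain_variation (ltW a0) p0 sl pl.
rewrite ltnS truncn_ge_nat//.
have : ((pvar_sum (@graph_path R w) p (g :: L))%:E <= v%:E)%E.
  by apply: le_trans hv; apply: pvar_sum_le_sorted.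
rewrite lee_fin => /(le_trans hL).
rewrite -ler_pdivlMr ?powR_gt0// => h; apply: (le_trans h).
by rewrite -(invf_div a 3) -(powR_inv1 (ltW a3)) -powRrM mulN1r powRN.
Qed.

End covering_variation.

(** * The length measure *)

Section chain_integral.
Context {R : realType} {d : measure_display} {X : measurableType d}.
Context (mu : {measure set X -> \bar R}) (f : X -> \bar R).
Context {disp : Order.disp_t} {I : orderType disp}.
Context (c : I -> I -> R) (B : I -> I -> set X).
Hypothesis f0 : forall x, (0 <= f x)%E.
Hypothesis mf : measurable_fun setT f.
Hypothesis mB : forall i j, measurable (B i j).
Hypothesis cB : forall i j, (i <= j)%O -> ((c i j)%:E <= \int[mu]_(x in B i j) f x)%E.
Hypothesis dB : forall i j k l, (i <= j)%O -> (j <= k)%O -> (k <= l)%O ->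
  B i j `&` B k l = set0.

(** The sets attached to the successive steps of the chain are disjoint, so their integrals add
    up. *)
Lemma chain_integral_le (s : seq I) : sorted <=%O s ->
  ((\sum_(xy <- zip s (behead s)) c xy.1 xy.2)%:E <= \int[mu]_x f x)%E.
Proof.
case: s => [|i s] /=; first by rewrite big_nil integral_ge0.
(* [S] is the union of the sets of the chain. It suffices to remember that its points come from
   pairs beyond [i]: this gives disjointness from the step before. *)
move=> si; suff [S [mS hS _]] : exists S, [/\ measurable S,
    ((\sum_(xy <- zip (i :: s) s) c xy.1 xy.2)%:E <= \int[mu]_(x in S) f x)%E &
    forall x, S x -> exists k l, [/\ (i <= k)%O, (k <= l)%O & B k l x]].
  apply: (le_trans hS); apply: ge0_subset_integral => //.
elim: s i si => [|j s ih] i /=.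
  by move=> _; exists set0; split; rewrite ?big_nil ?integral_set0.
move=> /andP[ij /ih[S [mS hS SP]]].
have disj : B i j `&` S = set0.
  apply/seteqP; split => // x [xB /SP[k [l [jk kl xk]]]].
  by rewrite -(dB ij jk kl); split.
exists (B i j `|` S); split; first exact: measurableU.
  rewrite ge0_integral_setU//.
  - by rewrite big_cons EFinD; apply: leeD => //; exact: cB.
  - exact: measurable_funS mf.
  - by rewrite disj_set2E disj.
move=> x [xB|/SP[k [l [jk kl xk]]]]; first by exists i, j.
by exists k, l; split => //; exact: le_trans jk.
Qed.

End chain_integral.

Lemma borel_closed (T : ptopologicalType) (A : set T) :
  closed A -> measurable (A : set (borel T)).
Proof.
move=> cA; rewrite -[A]setCK; apply: measurableC; apply: sub_sigma_algebra.
exact: closed_openC.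
Qed.

(** * Lengths of trimmed trees and integrals of the height *)

Section tree_measure.
Context {R : realType} (w : R -> R) (cw : cadlag w).
Local Notation T := (tree cw).
Context (O : T) (lam : {measure set (borel T) -> \bar R}).
Hypothesis lamP : forall x y : T, lam (Defs.arc x y) = (mdist x y)%:E.
Hypothesis ultra : forall x y z : T, Num.min (gprod O x y) (gprod O y z) <= gprod O x z.
Hypothesis down : forall (x : T) (r : R), 0 <= r <= mdist O x ->
  exists y, mdist O y = r /\ mdist y x = mdist O x - r.
Implicit Types (x y z : T) (a b r : R).

Let cT := @tree_compact R w cw.

Lemma measurable_arc y x : below O y x -> measurable (Defs.arc y x : set (borel T)).
Proof. by move=> yx; apply: borel_closed; exact: closed_arc yx. Qed.

Lemma measurable_trim a : measurable (trim O a : set (borel T)).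
Proof. by apply: borel_closed; exact: closed_trim. Qed.

Lemma measurable_height : measurable_fun setT (height O : borel T -> R).
Proof.
apply: (measurability (@RGenCInfty.G R)) => [|/= _ [_] [a] -> <-].
  exact: RGenCInfty.measurableE.
rewrite setTI (_ : _ @^-1` _ = trim O a); first exact: measurable_trim.
by apply/seteqP; split => x; rewrite /= in_itv/= andbT.
Qed.

Lemma below_at x r : 0 <= r <= mdist O x -> exists y, mdist O y = r /\ below O y x.
Proof. by move=> /down[y [h1 h2]]; exists y; rewrite /below; lra. Qed.

(* A point of [trim O a] at distance at least b from a leaf of [trim O a] above
   it has height at least a + b. *)
Lemma trim_length_step a b : 0 <= b -> finite_set (leaves O (trim O a)) ->
  (trim_length O lam a <= trim_length O lam (a + b) + b%:E * nleaves O a)%E.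
Proof.
move=> b0 fL; rewrite /nleaves /counting asboolT//.
set L := leaves _ _ in fL *.
(* [bot l] is the point at distance [b] below [l], or the root if the level of [l] is less than
   [b]. *)
have [bot botP] : {bot : T -> T & forall l,
    mdist O (bot l) = Num.max 0 (mdist O l - b) /\ below O (bot l) l}.
  apply: (@choice _ _ (fun l y =>
    mdist O y = Num.max 0 (mdist O l - b) /\ below O y l)) => l.
  by apply: below_at; rewrite le_max lexx ge_max mdist_ge0 gerBl b0.
pose A l : set (borel T) := Defs.arc (bot l) l.
have mA l : measurable (A l) by apply: measurable_arc; exact: (botP l).2.
have lA l : (lam (A l) <= b%:E)%E.
  rewrite lamP lee_fin; have [h1] := botP l; rewrite /below h1.
  have : mdist O l - b <= Num.max 0 (mdist O l - b) by rewrite le_max lexx orbT.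
  lra.
pose s : seq T := finmap.enum_fset (fset_set L).
have sub : trim O a `<=` trim O (a + b) `|` \big[setU/set0]_(l <- s) A l.
  move=> x xa; have [l lL xl] := leaf_above ultra down cT xa.
  have [ge_b|lt_b] := leP b (mdist x l).
    left; apply: le_trans (height_below ultra down cT xl).
    by have := lL.1; rewrite /trim/=; lra.
  right; rewrite -bigcup_seq; exists l; first by rewrite /= /s in_fset_set// inE.
  have [h1 h2] := botP l; apply/(arcP ultra down _ h2); split => //.
  apply: (below_level ultra h2 xl); rewrite h1 ge_max mdist_ge0/=.
  by move: xl; rewrite /below; lra.
have mU : measurable (\big[setU/set0]_(l <- s) A l) by apply: bigsetU_measurable.
have lU : (lam (\big[setU/set0]_(l <- s) A l) <= b%:E * (size s)%:R%:E)%E.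
  elim: s {sub mU} => [|l s ih]; first by rewrite big_nil measure0 mule0.
  rewrite big_cons; apply: le_trans (measureU2 _ _ _) _ => //.
    exact: bigsetU_measurable.
  rewrite /= -natr1 EFinD muleDr// mule1 addeC; apply: leeD => //.
apply: (@le_trans _ _ (lam (trim O (a + b) `|` \big[setU/set0]_(l <- s) A l))).
  apply: le_measure; rewrite ?inE//; first exact: measurable_trim.
  by apply: measurableU => //; exact: measurable_trim.
apply: le_trans (measureU2 _ _ _) _ => //; first exact: measurable_trim.
by apply: leeD.
Qed.

(** Each point of the lower half of the arc from the root to [x] has [x] above it, at distance at
    least half the level of [x], hence at least [a]. *)
Lemma trim_length_ge a x : 0 < a -> 2 * a <= mdist O x ->
  ((mdist O x / 2)%:E <= trim_length O lam a)%E.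
Proof.
move=> a0 ax; have x0 := mdist_ge0 O x.
have [y [y1 yx]] := @below_at x (mdist O x / 2) ltac:(lra).
have <- : lam (Defs.arc O y) = (mdist O x / 2)%:E by rewrite lamP y1.
apply: le_measure; rewrite ?inE.
- by apply: measurable_arc; exact: below_root.
- exact: measurable_trim.
move=> z /(arcP ultra down _ (below_root O y))[_ zy].
apply: le_trans (height_ge ultra down cT (below_trans zy yx)).
by have := below_trans zy yx; move: zy; rewrite /below; have := mdist_ge0 z y; lra.
Qed.

(* [A x y] is the middle third of the part above the level of x of the arc from
   the root to y. *)
Lemma middle_third : exists A : T -> T -> set (borel T), forall x y,
  let u := Num.max 0 (mdist O y - mdist O x) / 3 in
  [/\ measurable (A x y), lam (A x y) = u%:E &
    forall z, A x y z -> [/\ below O z y, ~ below O z x & u <= height O z]].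
Proof.
suff h x : exists A : T -> set (borel T), forall y,
    let u := Num.max 0 (mdist O y - mdist O x) / 3 in
    [/\ measurable (A y), lam (A y) = u%:E &
      forall z, A y z -> [/\ below O z y, ~ below O z x & u <= height O z]].
  by have [A AP] := choice h; exists A.
suff h y : exists A : set (borel T),
    let u := Num.max 0 (mdist O y - mdist O x) / 3 in
    [/\ measurable A, lam A = u%:E &
      forall z, A z -> [/\ below O z y, ~ below O z x & u <= height O z]].
  by have [A AP] := choice h; exists A.
have x0 := mdist_ge0 O x; case: (leP 0 (mdist O y - mdist O x)) => xy /=; last first.
  by exists set0; split; rewrite ?mul0r ?measure0.
set u := _ / 3; have u0 : 0 <= u by rewrite divr_ge0.
have uE : mdist O y = mdist O x + u + u + u by rewrite /u; field.
(* For equal levels the arc would shrink to [y], which may be [x] itself; the empty set is taken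
   instead. *)
move: xy; rewrite subr_ge0 le_eqVlt => /predU1P[xy|xy].
  exists set0; split; rewrite ?measure0//.
  by congr EFin; rewrite /u xy subrr mul0r.
have {}u0 : 0 < u by rewrite divr_gt0 ?subr_gt0.
have [y1 [l1 b1]] := @below_at y (mdist O x + u) ltac:(lra).
have [y2 [l2 b2]] := @below_at y (mdist O x + u + u) ltac:(lra).
have b12 : below O y1 y2 by apply: (below_level ultra b1 b2); lra.
exists (Defs.arc y1 y2); split; first exact: measurable_arc.
  by rewrite lamP; congr EFin; move: b12; rewrite /below l1 l2; lra.
move=> z /(arcP ultra down _ b12)[z1 z2]; have zy := below_trans z2 b2; split => //.
  by move=> /below_le; have := below_le z1; lra.
apply: le_trans (height_ge ultra down cT zy).
by have := below_le z2; move: zy; rewrite /below; lra.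
Qed.

(* Dyadic layer-cake bound: m k = M / 2 ^ k, and the height of x is at most m k
   and at least m k.+1 for some k, unless it is 0. *)
Lemma integral_height_lt r q C M : 0 < r -> q < r -> 0 <= C -> 0 < M ->
  (forall x, mdist O x <= M) ->
  (forall a, 0 < a <= M -> (trim_length O lam a <= (C * a `^ (- q))%:E)%E) ->
  (\int[lam]_(x in setT) (height O x `^ r)%:E < +oo)%E.
Proof.
move=> r0 qr C0 M0 xM hL.
have hM x : height O x <= M.
  have [y [xy -> _]] := height_attained ultra down cT x; have := mdist_ge0 O x.
  by have := xM y; move: xy; rewrite /below; lra.
pose m k : R := M * 2^-1 ^+ k.
have m0 k : 0 < m k by rewrite mulr_gt0// exprn_gt0.
have mS k : m k.+1 = m k / 2 by rewrite /m exprSr mulrA.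
have mM k : m k <= M.
  by rewrite /m ler_piMr ?(ltW M0)// exprn_ile1// ?invr_ge0// invf_le1// ler1n.
(* On the layer where the height is between m k.+1 and m k, the k-th term alone dominates the
   integrand. *)
pose F k (x : borel T) : \bar R := ((m k `^ r)%:E * (\1_(trim O (m k.+1)) x)%:E)%E.
have mind k : measurable_fun setT
    (fun x : borel T => ((\1_(trim O (m k.+1)) x)%:E : \bar R)).
  apply/measurable_EFinP; apply: measurable_indic; exact: measurable_trim.
have mF k : measurable_fun setT (F k).
  by apply: emeasurable_funM => //; exact: measurable_cst.
have F0 k x : (0 <= F k x)%E by rewrite mule_ge0// lee_fin ?powR_ge0.
have le_F x : ((height O x `^ r)%:E <= \sum_(k <oo) F k x)%E.
  have := height_ge0 ultra down cT x; rewrite le_eqVlt => /predU1P[<-|h0].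
    by rewrite powR0 ?gt_eqF//; apply: nneseries_ge0.
  have exk : exists k, m k.+1 <= height O x.
    (* This index works because 2 ^ n > n. *)
    exists (Num.trunc (M / height O x)).
    rewrite /m exprVn ler_pdivrMr ?exprn_gt0// mulrC -ler_pdivrMr//.
    apply: (@le_trans _ _ (Num.trunc (M / height O x)).+1%:R).
      by apply/ltW; rewrite -truncn_le_nat.
    by rewrite -natrX ler_nat ltnW// ltn_expl.
  case: (ex_minnP exk) => k hk kmin.
  have hmk : height O x <= m k.
    case: k hk kmin => [|k] hk kmin; first by rewrite /m expr0 mulr1.
    by rewrite leNgt; apply/negP => /ltW /kmin; rewrite ltnn.
  apply: le_trans (nneseries_lim_ge (P := xpredT) k.+1 (fun n _ _ => F0 n x)).
  rewrite big_nat_recr//=; apply: (@le_trans _ _ (F k x)).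
    rewrite /F indicE mem_set// mule1 lee_fin.
    by apply: ge0_ler_powR; rewrite ?nnegrE ?(ltW r0) ?(ltW h0) ?(ltW (m0 k)).
  by rewrite leeDr// sume_ge0.
apply: (@le_lt_trans _ _ (\int[lam]_x (\sum_(k <oo) F k x)))%E.
  apply: ge0_le_integral => //.
  - by move=> x _; rewrite lee_fin powR_ge0.
  - apply/measurable_EFinP.
    apply: (@measurableT_comp _ _ _ _ _ _ (fun x : R => x `^ r)) => //.
    exact: measurable_height.
  - exact: ge0_emeasurable_sum.
rewrite integral_nneseries//.
(* Halving m k multiplies its power r - q by [rho], so that q < r gives a geometric series. In [K],
   the power 2 ^ q comes from m k.+1 = m k / 2. *)
pose rho := 2^-1 `^ (r - q) : R.
have i2 : 0 <= 2^-1 :> R by rewrite invr_ge0.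
have rho0 : 0 < rho < 1.
  rewrite powR_gt0/= ?invr_gt0// /rho.
  have e1 : 1 `^ (r - q) = 1 :> R by rewrite powR1.
  have h1 : 2^-1 < 1 :> R by lra.
  by rewrite -[ltRHS]e1; apply: gt0_ltr_powR; rewrite ?nnegrE ?subr_gt0.
pose K := C * 2 `^ q * M `^ (r - q).
have K0 : 0 <= K by rewrite !mulr_ge0 ?powR_ge0.
have le_g k : (\int[lam]_x F k x <= (geometric K rho k)%:E)%E.
  rewrite ge0_integralZl_EFin ?powR_ge0//.
  rewrite integral_indic ?setIT//; last exact: measurable_trim.
  apply: (@le_trans _ _ ((m k `^ r)%:E * (C * m k.+1 `^ (- q))%:E)%E).
    by apply: lee_wpmul2l; rewrite ?lee_fin ?powR_ge0//; apply: hL; rewrite m0 mM.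
  rewrite -EFinM lee_fin /geometric/= mS powRM ?(ltW (m0 k))//.
  have -> : 2^-1 `^ (- q) = 2 `^ q :> R.
    by rewrite -powR_inv1// -powRrM mulN1r opprK.
  have -> : m k `^ r * (C * (m k `^ (- q) * 2 `^ q)) =
      C * 2 `^ q * (m k `^ r * m k `^ (- q)) by ring.
  have mN : m k != 0 by rewrite gt_eqF.
  rewrite -powRD; last by rewrite mN implybT.
  rewrite /m powRM ?exprn_ge0 ?(ltW M0)//.
  have -> : (2^-1 ^+ k) `^ (r - q) = rho ^+ k.
    by rewrite /rho -(powR_mulrn k i2) -powRrM mulrC powRrM powR_mulrn ?powR_ge0.
  by rewrite /K !mulrA.
have : (\sum_(k <oo) (\int[lam]_x F k x) <= (K * (1 - rho)^-1)%:E)%E.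
  apply: lime_le; first by apply: is_cvg_nneseries => k _ _; apply: integral_ge0.
  near=> n; apply: (@le_trans _ _ (\sum_(0 <= k < n) (geometric K rho k)%:E)%E).
    exact: lee_sum.
  rewrite sumEFin lee_fin.
  have /andP[rho0' rho1] := rho0.
  by apply: geometric_le_lim; rewrite // gtr0_norm.
by move=> /le_lt_trans; apply; rewrite ltry.
Unshelve. all: by end_near. Qed.

End tree_measure.

(** * Growth exponents *)

Section growth.
Context {R : realType}.
Implicit Types (f g : R -> \bar R) (a q c C r : R).

Lemma at_right0P (V : set R) :
  (0^'+ V) <-> exists2 d, 0 < d & forall a, 0 < a < d -> V a.
Proof.
split.
  rewrite /at_right /within /= => -[d /= d0 hd]; exists d => // a /andP[a0 ad].
  by apply: hd => //=; rewrite sub0r normrN gtr0_norm.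
move=> [d d0 hd]; near=> a; apply: hd; apply/andP; split.
  by near: a; exact: nbhs_right_gt.
by near: a; exact: nbhs_right_lt.
Unshelve. all: by end_near. Qed.

Definition ratio f a : \bar R := (lne (f a) / (ln a^-1)%:E)%E.

Lemma growth_exponentE f :
  growth_exponent f = ereal_inf [set ereal_sup (ratio f @` V) | V in (0 : R)^'+].
Proof. by []. Qed.

Lemma ln_inv_gt0 a : 0 < a < 1 -> 0 < ln a^-1.
Proof. by move=> /andP[a0 a1]; rewrite ln_gt0// invf_gt1. Qed.

Lemma lne_le (x y : \bar R) : (x <= y)%E -> (lne x <= lne y)%E.
Proof.
move=> xy; have [x0|x0] := leP x 0%E; first by rewrite le0_lneNy// leNye.
by rewrite lee_lne// in_itv/= leey ?(ltW x0)// (le_trans (ltW x0)).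
Qed.

Lemma ratio_le f g a : 0 < a < 1 -> (f a <= g a)%E -> (ratio f a <= ratio g a)%E.
Proof.
move=> a01 fg; rewrite /ratio inver gt_eqF ?ln_inv_gt0//.
by apply: lee_wpmul2r; [rewrite lee_fin invr_ge0 ltW ?ln_inv_gt0|exact: lne_le].
Qed.

Lemma ratio_powR C q a : 0 < C -> 0 < a < 1 ->
  ratio (fun a => (C * a `^ (- q))%:E) a = (q + ln C / ln a^-1)%:E.
Proof.
move=> C0 a01; have L0 := ln_inv_gt0 a01; have /andP[a0 a1] := a01.
rewrite /ratio lne_EFin ?mulr_gt0 ?powR_gt0// inver gt_eqF// -EFinM; congr EFin.
rewrite lnM ?posrE ?powR_gt0// ln_powR mulNr -mulrN -lnV ?posrE//.
by rewrite mulrDl mulfK ?gt_eqF// addrC.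
Qed.

Lemma ln_div_small C e : 0 < e ->
  exists2 d, 0 < d <= 2^-1 & forall a, 0 < a < d -> `|ln C / ln a^-1| <= e.
Proof.
(* The exponential makes ln (1 / a) larger than |ln C| / e, and 1 / 2 keeps a < 1, where this
   logarithm is positive. *)
move=> e0; pose d := Num.min 2^-1 (expR (- (`|ln C| / e))).
exists d; first by rewrite lt_min expR_gt0 invr_gt0 ltr0n/= ge_min lexx.
move=> a /andP[a0]; rewrite lt_min => /andP[a2 ae].
have h2 : 2^-1 < 1 :> R by lra.
have L0 : 0 < ln a^-1 by rewrite ln_inv_gt0// a0 (lt_trans a2).
rewrite normrM normfV (gtr0_norm L0) ler_pdivrMr// mulrC -ler_pdivrMr//.
rewrite lnV ?posrE// lerNr ltW//.
by rewrite -ltr_expR lnK ?posrE.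
Qed.

(** The constant [C] adds ln C / ln (1 / a) to the ratio, and this tends to 0. *)
Lemma growth_exponent_le f q C a0 : 0 < C -> 0 < a0 ->
  (forall a, 0 < a < a0 -> (f a <= (C * a `^ (- q))%:E)%E) ->
  (growth_exponent f <= q%:E)%E.
Proof.
move=> C0 a00 fC; apply/lee_addgt0Pr => e e0.
have [d /andP[d0 d2] hd] := @ln_div_small C e e0.
rewrite growth_exponentE.
apply: (@le_trans _ _ (ereal_sup (ratio f @` [set a | 0 < a < Num.min d a0]))).
  apply: ereal_inf_lbound; exists [set a | 0 < a < Num.min d a0] => //.
  by apply/at_right0P; exists (Num.min d a0) => //; rewrite lt_min d0.
apply: ge_ereal_sup => _ [a /= /andP[a1 am] <-].
move: am; rewrite lt_min => /andP[ad aa0].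
have a01 : 0 < a < 1 by lra.
apply: le_trans (ratio_le (g := fun a => (C * a `^ (- q))%:E) a01 _) _.
  by apply: fC; rewrite a1.
rewrite ratio_powR// -EFinD lee_fin lerD2l.
by apply: le_trans (ler_norm _) _; apply: hd; rewrite a1.
Qed.

Lemma growth_exponent_ge f q C a0 : 0 < C -> 0 < a0 ->
  (forall a, 0 < a < a0 -> ((C * a `^ (- q))%:E <= f a)%E) ->
  (q%:E <= growth_exponent f)%E.
Proof.
move=> C0 a00 fC; rewrite growth_exponentE.
apply: le_ereal_inf_tmp => _ [V /at_right0P[v v0 hV] <-].
apply/lee_subgt0Pr => e e0; have [d /andP[d0 d2] hd] := ln_div_small C e0.
(* One value of [a] below all three thresholds bounds the supremum over the neighbourhood from
   below. *)
pose a := Num.min (Num.min v d) a0 / 2.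
have m0 : 0 < Num.min (Num.min v d) a0 by rewrite !lt_min v0 d0.
have : a < Num.min (Num.min v d) a0 by rewrite /a; lra.
rewrite !lt_min => /andP[/andP[av ad] aa0].
have a1 : 0 < a by rewrite divr_gt0.
have a01 : 0 < a < 1 by lra.
apply: (@le_trans _ _ (ratio f a)); last first.
  by apply: ereal_sup_ubound; exists a => //; apply: hV; rewrite a1.
apply: le_trans (ratio_le (f := fun a => (C * a `^ (- q))%:E) a01 _); last first.
  by apply: fC; rewrite a1.
rewrite ratio_powR// -EFinB lee_fin lerD2l lerNl.
by apply: le_trans (hd a _); rewrite ?a1// -normrN ler_norm.
Qed.

Lemma growth_exponent_mono f g : (forall a, 0 < a -> (f a <= g a)%E) ->
  (growth_exponent f <= growth_exponent g)%E.
Proof.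
move=> fg; rewrite !growth_exponentE.
apply: le_ereal_inf_tmp => _ [V /at_right0P[v v0 hV] <-].
pose V' : set R := [set a | 0 < a < Num.min v 1].
apply: (@le_trans _ _ (ereal_sup (ratio f @` V'))).
  apply: ereal_inf_lbound; exists V' => //; apply/at_right0P; exists (Num.min v 1) => //.
  by rewrite lt_min v0 ltr01.
apply: ge_ereal_sup => _ [a /= /andP[a0 am] <-].
move: am; rewrite lt_min => /andP[av a1].
have a01 : 0 < a < 1 by rewrite a0.
apply: le_trans (ratio_le a01 (fg a a0)) _.
by apply: ereal_sup_ubound; exists a => //; apply: hV; rewrite a0.
Qed.

(** The upper limit is an infimum of suprema over right neighbourhoods of 0, so a strict bound holds
    on a whole one of them; a < 1 / 2 keeps the logarithm positive. *)
Lemma growth_exponent_lt f q : (growth_exponent f < q%:E)%E ->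
  exists2 a0, 0 < a0 <= 2^-1 & forall a, 0 < a < a0 -> (f a <= (a `^ (- q))%:E)%E.
Proof.
rewrite growth_exponentE => /ereal_inf_lt[_ [V /at_right0P[v v0 hV] <-] Vq].
have i2 : 0 < 2^-1 :> R by rewrite invr_gt0.
exists (Num.min v 2^-1); first by rewrite lt_min v0 i2 ge_min lexx orbT.
move=> a /andP[a0]; rewrite lt_min => /andP[av a2].
have h2 : 2^-1 < 1 :> R by lra.
have a01 : 0 < a < 1 by rewrite a0 (lt_trans a2).
have : (ratio f a < q%:E)%E.
  apply: le_lt_trans Vq; apply: ereal_sup_ubound; exists a => //.
  by apply: hV; rewrite a0.
rewrite leNgt => h; apply/negP => /ltW af; move: h; apply/negP; rewrite -leNgt.
apply: le_trans (ratio_le (f := fun a => (1 * a `^ (- q))%:E) a01 _).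
  by rewrite ratio_powR// ln1 mul0r addr0.
by rewrite mul1r.
Qed.

End growth.

(** * Comparison of the indices *)

Section variation_le_integral.
Context {R : realType} (w : R -> R) (cw : cadlag w).
Context (U : R) (U01 : U \in `[0, 1]).
Hypothesis U_min : low w U = inf [set w t | t in `[0, 1]].
Local Notation O := (\pi_(tree cw) (graph_low w U01)).
Context (lam : {measure set (borel (tree cw)) -> \bar R}).
Hypothesis lamP : forall x y : tree cw, lam (Defs.arc x y) = (mdist x y)%:E.
Local Notation pi_ := (\pi_(tree cw)).

Let ultra := @tree_ultra R w cw U U01 U_min.
Let down := @tree_down R w cw U U01 U_min.
Let cT := @tree_compact R w cw.

(** The infimum from [g1] to [g3], hence also that from [g1] to [g2], is at least as high as [z];
    the branching inequality through [g1] concludes. *)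
Lemma below_convex (z : tree cw) (g1 g2 g3 : graph w) : (g1 <= g2)%O -> (g2 <= g3)%O ->
  below O z (pi_ g1) -> below O z (pi_ g3) -> below O z (pi_ g2).
Proof.
move=> l12 l23; rewrite !belowE => z1 z3.
have := ultra (pi_ g1) z (pi_ g3); rewrite gprodC z1 z3 minxx gprod_pi// => h13.
have := graph_inf_mono cw l12 l23 => h.
have := ultra z (pi_ g1) (pi_ g2); rewrite z1 gprod_pi// => h2.
apply/eqP; rewrite eq_le (gprod_le O z (pi_ g2)).1/=.
by apply: le_trans h2; rewrite le_min lexx/=; lra.
Qed.

(* The middle thirds of the arcs climbed by a path of increasing points are
   pairwise disjoint: the points of the graph above a given z form an interval,
   so that z is entered only once. The same holds for the arcs descended. *)
Lemma pvariation_le_integral p : 1 <= p ->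
  (pvariation setT (@graph_path R w) p <=
   (3 `^ p)%:E * (\int[lam]_(x in setT) (height O x `^ (p - 1))%:E +
                  \int[lam]_(x in setT) (height O x `^ (p - 1))%:E))%E.
Proof.
move=> p1; have p0 : 0 < p by rewrite (lt_le_trans ltr01).
have pB : 0 <= p - 1 by rewrite subr_ge0.
have [A AP] := middle_third lamP ultra down.
pose c (g h : graph w) := (Num.max 0 (graph_path h - graph_path g) / 3) `^ p.
pose f (x : borel (tree cw)) := (height O x `^ (p - 1))%:E.
have f0 x : (0 <= f x)%E by rewrite lee_fin powR_ge0.
have mf : measurable_fun setT f.
  apply/measurable_EFinP.
  apply: (@measurableT_comp _ _ _ _ _ _ (fun x : R => x `^ (p - 1))) => //.
  exact: measurable_height ultra down.
have mA g h : measurable (A (pi_ g) (pi_ h)) by have [] := AP (pi_ g) (pi_ h).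
have cA g h : ((c g h)%:E <= \int[lam]_(x in A (pi_ g) (pi_ h)) f x)%E.
  have [_ lA hA] := AP (pi_ g) (pi_ h); move: lA hA; rewrite !level_pi//.
  have -> : graph_path h - low w U - (graph_path g - low w U) =
    graph_path h - graph_path g by ring.
  rewrite /c; set u := _ / 3 => lA hA.
  have u0 : 0 <= u by rewrite divr_ge0// le_max lexx.
  (* A set of length [u] on which the height is at least [u] contributes at least u * u ^ (p - 1) =
     u ^ p. *)
  apply: (@le_trans _ _ (\int[lam]_(x in A (pi_ g) (pi_ h)) cst (u `^ (p - 1))%:E x)%E).
    by rewrite integral_cst// lA -EFinM mulrC mulr_powRB1.
  apply: ge0_le_integral => //.
  - by move=> x _; rewrite lee_fin powR_ge0.
  - exact: measurable_funS mf.
  - move=> x /hA[_ _ ux]; rewrite lee_fin.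
    by apply: ge0_ler_powR; rewrite ?nnegrE// (le_trans u0).
have up (s : seq (graph w)) : sorted <=%O s ->
    ((\sum_(xy <- zip s (behead s)) c xy.1 xy.2)%:E <= \int[lam]_x f x)%E.
  apply: (chain_integral_le (B := fun g h => A (pi_ g) (pi_ h))) => //.
  move=> i j k l ij jk kl; rewrite -subset0 => z [].
  have [_ _ h1] := AP (pi_ i) (pi_ j); have [_ _ h2] := AP (pi_ k) (pi_ l).
  move=> /h1[z1 nz1 _] /h2[z2 nz2 _].
  by apply: nz2; apply: below_convex z1 z2.
have dn (s : seq (graph w)) : sorted <=%O s ->
    ((\sum_(xy <- zip s (behead s)) c xy.2 xy.1)%:E <= \int[lam]_x f x)%E.
  apply: (chain_integral_le (c := fun g h => c h g)
    (B := fun g h => A (pi_ h) (pi_ g))) => //.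
  move=> i j k l ij jk kl; rewrite -subset0 => z [].
  have [_ _ h1] := AP (pi_ j) (pi_ i); have [_ _ h2] := AP (pi_ l) (pi_ k).
  move=> /h1[z1 nz1 _] /h2[z2 nz2 _].
  by apply: nz1; apply: below_convex z1 z2.
apply: ge_ereal_sup => _ [s [ss _] <-].
have {}ss : sorted <=%O s by move: ss; rewrite lt_sorted_uniq_le => /andP[].
(* Every increment is a rise or a fall, so one of the two sums accounts for it; 3 ^ p undoes the
   division by 3. *)
apply: (@le_trans _ _ ((3 `^ p)%:E * ((\sum_(xy <- zip s (behead s)) c xy.1 xy.2)%:E +
    (\sum_(xy <- zip s (behead s)) c xy.2 xy.1)%:E))%E); last first.
  by apply: lee_wpmul2l; rewrite ?lee_fin ?powR_ge0//; apply: leeD; [exact: up|exact: dn].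
rewrite -EFinD -EFinM lee_fin -big_split/= mulr_sumr; apply: ler_sum => -[g h] _ /=.
have cge k l : 0 <= c k l by exact: powR_ge0.
have key k l : 0 <= graph_path l - graph_path k ->
    (graph_path l - graph_path k) `^ p = 3 `^ p * c k l.
  move=> kl; rewrite /c (max_r kl) -powRM ?divr_ge0//; congr powR.
  by field.
have [gh|gh] := leP 0 (graph_path h - graph_path g).
  by rewrite ger0_norm// key// ler_wpM2l ?powR_ge0// lerDl.
rewrite ltr0_norm// opprB key; last by lra.
by rewrite ler_wpM2l ?powR_ge0// lerDr.
Qed.

End variation_le_integral.

(** * The inequalities of the cycle *)

Section exponents.
Context {R : realType} (w : R -> R) (cw : cadlag w).
Context (U : R) (U01 : U \in `[0, 1]).
Hypothesis U_min : low w U = inf [set w t | t in `[0, 1]].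
Hypothesis w_nonconst : exists s t : R, [/\ s \in `[0, 1], t \in `[0, 1] & w s != w t].
Local Notation T := (tree cw).
Local Notation O := (\pi_(tree cw) (graph_low w U01)).
Context (lam : {measure set (borel (tree cw)) -> \bar R}).
Hypothesis lamP : forall x y : tree cw, lam (Defs.arc x y) = (mdist x y)%:E.

Let ultra := @tree_ultra R w cw U U01 U_min.
Let down := @tree_down R w cw U U01 U_min.
Let cT := @tree_compact R w cw.
Local Notation L := (trim_length O lam).
Local Notation N := (nleaves O).
Local Notation V := (variation_index `[0, 1] w).

(** Of two distinct values of [w], at least one exceeds the minimal level. *)
Lemma level_gt0 : exists x : T, 0 < mdist O x.
Proof.
have [s [t [s01 t01 st]]] := w_nonconst.
have hs := low_min_path cw U_min (graph_pt w s).
have ht := low_min_path cw U_min (graph_pt w t).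
rewrite !path_graph_pt// in hs ht.
have [ws|ws] := eqVneq (w s) (low w U).
  exists (\pi_(tree cw) (graph_pt w t)); rewrite level_pi// path_graph_pt// subr_gt0.
  by rewrite lt_neqAle ht andbT -ws.
exists (\pi_(tree cw) (graph_pt w s)); rewrite level_pi// path_graph_pt// subr_gt0.
by rewrite lt_neqAle hs andbT eq_sym.
Qed.

Lemma level_bounded : exists2 M, 0 < M & forall x : T, mdist O x <= M.
Proof.
have [x x0] := level_gt0.
have [|y _ hy] := compact_EVT_max _ cT (continuous_subspaceT (@continuous_mdist _ _ O)).
  by exists x.
exists (mdist O y); last by move=> z; apply: hy; rewrite inE.
by apply: lt_le_trans x0 _; apply: hy; rewrite inE.
Qed.

Lemma height_bounded M x : (forall x : T, mdist O x <= M) -> height O x <= M.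
Proof.
move=> hM; have [y [xy -> _]] := height_attained ultra down cT x.
by have := hM y; have := mdist_ge0 O x; move: xy; rewrite /below; lra.
Qed.

Lemma trim_length_nincr a b : a <= b -> (L b <= L a)%E.
Proof.
move=> ab; apply: le_measure; rewrite ?inE.
- exact: measurable_trim ultra down b.
- exact: measurable_trim ultra down a.
- by move=> x; apply: le_trans.
Qed.

Lemma variation_index_le_height : (V <= height_index O lam)%E.
Proof.
apply: le_ereal_inf_tmp => _ [p [p1 hp] <-].
apply: ereal_inf_lbound; exists p => //; split => //.
have h := @pvariation_le_integral _ _ cw _ U01 U_min lam lamP p p1.
rewrite /= pvariation_graph//. apply: (le_lt_trans h).
by apply: lte_mul_pinfty; rewrite ?lee_fin ?powR_ge0//; exact: lte_add_pinfty.
Qed.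

(** The trimmed length stays away from 0 as [a] decreases. This ensures that the exponent l + 1 + e
    chosen in [height_index_le_length] is at least 1. *)
Lemma length_exponent_ge0 : (0 <= growth_exponent L)%E.
Proof.
have [x x0] := level_gt0; have x2 : 0 < mdist O x / 2 by rewrite divr_gt0.
apply: (growth_exponent_ge x2 x2) => a /andP[a0 ax].
by rewrite oppr0 powRr0 mulr1; apply: trim_length_ge => //; lra.
Qed.

Lemma height_index_le_length : (height_index O lam <= growth_exponent L + 1)%E.
Proof.
have := length_exponent_ge0.
case LE : (growth_exponent L) => [l| |] // l0; last by rewrite leey.
rewrite lee_fin in l0; apply/lee_addgt0Pr => e e0.
have [a0 /andP[a00 _] ha] : exists2 a0, 0 < a0 <= 2^-1 &
    forall a, 0 < a < a0 -> (L a <= (a `^ (- (l + e / 2)))%:E)%E.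
  by apply: growth_exponent_lt; rewrite LE lte_fin; lra.
have [M M0 hM] := level_bounded.
set q := l + e / 2 in ha; have q0 : 0 < q by rewrite /q; lra.
have -> : (l%:E + 1 + e%:E = (l + 1 + e)%:E)%E by [].
(* The height is then raised to the power l + e, larger than the growth rate q = l + e / 2 of the
   trimmed length. *)
apply: ereal_inf_lbound; exists (l + 1 + e) => //; split; first lra.
pose a1 := a0 / 2; have a10 : 0 < a1 by rewrite divr_gt0.
have C0 : 0 <= a1 `^ (- q) * M `^ q by rewrite mulr_ge0 ?powR_ge0.
apply: (@integral_height_lt _ _ _ O lam ultra down (l + 1 + e - 1) q
  (1 + a1 `^ (- q) * M `^ q) M) => //; [lra|rewrite /q; lra|exact: addr_ge0|].
move=> a /andP[a_gt0 aM]; have [aa1|a1a] := ltP a a0.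
  apply: le_trans (ha a _) _; first by rewrite a_gt0.
  by rewrite lee_fin mulrDl mul1r lerDl mulr_ge0 ?powR_ge0.
(* Between [a0] and [M], monotonicity bounds the length by its value at [a1], and the factor M ^ q
   compensates a ^ (- q). *)
apply: (@le_trans _ _ (L a1)); first by apply: trim_length_nincr; rewrite /a1; lra.
apply: le_trans (ha a1 _) _; first by rewrite a10/= /a1; lra.
rewrite lee_fin mulrDl; apply: ler_wpDl; first by rewrite mulr_ge0 ?powR_ge0.
rewrite -mulrA ler_peMr ?powR_ge0// powRN -ler_pdivrMr ?invr_gt0 ?powR_gt0//.
rewrite invrK mul1r; apply: ge0_ler_powR => //; first exact: ltW.
  by rewrite nnegrE ltW.
by rewrite nnegrE ltW.
Qed.

Lemma finite_leaves a : (N a < +oo)%E -> finite_set (leaves O (trim O a)).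
Proof. by rewrite /nleaves /counting; case: ifPn => // /asboolP. Qed.

(** Iterating [trim_length_step] over a, 2a, 4a, ... up to [a0] sums terms (2 ^ k a) ^ (1 - q), a
    geometric series as q > 1. *)
Lemma trim_length_le q a0 : 1 < q -> 0 < a0 ->
  (forall a, 0 < a < a0 -> (N a <= (a `^ (- q))%:E)%E) ->
  exists2 K, 0 < K & forall a, 0 < a < a0 -> (L a <= (K * a `^ (- (q - 1)))%:E)%E.
Proof.
move=> q1 a00 hN; have [M M0 hM] := level_bounded.
pose s := q - 1; have s0 : 0 < s by rewrite subr_gt0.
have r1 : 2 `^ (- s) < 1 :> R.
  rewrite powRN invf_lt1 ?powR_gt0//.
  have e1 : 1 `^ s = 1 :> R by rewrite powR1.
  by rewrite -[ltLHS]e1; apply: gt0_ltr_powR; rewrite ?nnegrE// ltr1n.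
(* [K1] solves K1 * 2 ^ (- s) + 1 = K1, which carries the bound through a doubling; [K2] serves the
   last scale, where 2a is at least [a0]. *)
pose K1 := (1 - 2 `^ (- s))^-1 : R; pose K2 := 2 * (M + 1) / a0.
have K10 : 0 < K1 by rewrite invr_gt0 subr_gt0.
have K20 : 0 < K2 by rewrite divr_gt0// mulr_gt0// addr_gt0.
exists (K1 + K2); first by rewrite addr_gt0.
have aq a : 0 < a -> a * a `^ (- q) = a `^ (- s).
  move=> a_gt0; have -> : - s = 1 + (- q) by rewrite /s; ring.
  by rewrite powRD ?(gt_eqF a_gt0) ?implybT// powRr1// ltW.
(* Induction on the number of doublings needed to reach [a0]; none is impossible since a < a0. *)
have H n a : 0 < a < a0 -> a0 <= 2 ^+ n * a -> (L a <= ((K1 + K2) * a `^ (- s))%:E)%E.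
  elim: n a => [|n ih] a aa0; first by rewrite expr0 mul1r => h; exfalso; lra.
  move=> an; have /andP[a_gt0 _] := aa0.
  have fL : finite_set (leaves O (trim O a)).
    by apply: finite_leaves; apply: le_lt_trans (hN a aa0) _; rewrite ltry.
  have as0 : 0 < a `^ (- s) by rewrite powR_gt0.
  have [a2|a2] := ltP (2 * a) a0.
    apply: le_trans (trim_length_step lamP ultra down (ltW a_gt0) fL) _.
    have hL : (L (a + a) <= ((K1 + K2) * (2 * a) `^ (- s))%:E)%E.
      have -> : a + a = 2 * a by ring.
      by apply: ih; [rewrite a2 mulr_gt0|rewrite mulrA -exprSr].
    have hN' : (a%:E * N a <= (a `^ (- s))%:E)%E.
      rewrite -aq// EFinM; apply: lee_wpmul2l; first by rewrite lee_fin ltW.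
      exact: hN.
    apply: le_trans (leeD hL hN') _; rewrite -EFinD lee_fin.
    rewrite powRM ?(ltW a_gt0)// mulrA -[X in _ + X]mul1r -mulrDl ler_wpM2r ?(ltW as0)//.
    have h1 : K1 * (1 - 2 `^ (- s)) = 1 by rewrite mulVf// gt_eqF// subr_gt0.
    have h2 : 0 <= K2 * (1 - 2 `^ (- s)) by rewrite mulr_ge0 ?(ltW K20)// subr_ge0 ltW.
    by lra.
  (* A single step longer than every height exhausts the tree. *)
  have M1 : 0 <= M + 1 by lra.
  apply: le_trans (trim_length_step lamP ultra down M1 fL) _.
  have -> : L (a + (M + 1)) = 0%E.
    rewrite /trim_length (_ : trim O _ = set0) ?measure0// -subset0 => x.
    by rewrite /trim/=; have := height_bounded x hM; lra.
  rewrite add0e; apply: le_trans (lee_wpmul2l _ (hN a aa0)) _; first by rewrite lee_fin.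
  rewrite -EFinM lee_fin -aq// mulrA ler_wpM2r ?powR_ge0//.
  rewrite mulrDl; apply: ler_wpDl; first by rewrite mulr_ge0 ?ltW.
  by rewrite /K2 mulrAC ler_pdivlMr//; nra.
move=> a aa0; have /andP[a_gt0 _] := aa0.
apply: (H (Num.trunc (a0 / a)).+1) => //.
rewrite -ler_pdivrMr//; apply: (@le_trans _ _ (Num.trunc (a0 / a)).+1%:R).
  by apply/ltW; rewrite -truncn_le_nat.
by rewrite -natrX ler_nat ltnW// ltn_expl.
Qed.

Lemma length_exponent_le_leaves :
  (growth_exponent L + 1 <= maxe (growth_exponent N) 1)%E.
Proof.
(* The maximum with 1 gives m + e > 1, as [trim_length_le] requires. *)
have m1 : (1 <= maxe (growth_exponent N) 1)%E by rewrite le_max lexx orbT.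
case ME : (maxe _ _) m1 => [m| |] // m1; last by rewrite leey.
rewrite lee_fin in m1; apply/lee_addgt0Pr => e e0; rewrite -EFinD.
have [a0 /andP[a00 _] ha] : exists2 a0, 0 < a0 <= 2^-1 &
    forall a, 0 < a < a0 -> (N a <= (a `^ (- (m + e)))%:E)%E.
  apply: growth_exponent_lt; apply: (@le_lt_trans _ _ m%:E); last by rewrite lte_fin; lra.
  by rewrite -ME le_max lexx.
have [K K0 hK] := trim_length_le (ltac:(lra) : 1 < m + e) a00 ha.
have := growth_exponent_le K0 a00 hK.
by rewrite EFinB leeBrDr.
Qed.

Lemma leaves_exponent_le_dim : (maxe (growth_exponent N) 1 <= upper_dim T)%E.
Proof.
rewrite ge_max; apply/andP; split.
  by apply: growth_exponent_mono => a _; exact: nleaves_le_covering.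
(* The levels below one point other than the root already require a constant over [a] balls, hence
   the exponent 1. *)
have [x x0] := level_gt0; have x2 : 0 < mdist O x / 2 by rewrite divr_gt0.
apply: (growth_exponent_ge x2 ltr01) => a /andP[a0 _].
apply: le_trans (covering_ge_level down x a0); rewrite lee_fin powR_inv1 ?(ltW a0)//.
by rewrite invfM mulrA lexx.
Qed.

Lemma dim_le_variation_index : (upper_dim T <= V)%E.
Proof.
apply: le_ereal_inf_tmp => _ [p [p1 hp] <-].
have vE := pvariation_graph cw p1; set v := fine (pvariation setT (@graph_path R w) p).
have v0 := pvariation_ge0 setT (@graph_path R w) p.
have vfin : pvariation setT (@graph_path R w) p \is a fin_num.
  by rewrite ge0_fin_numE// -vE.
have v_ge0 : 0 <= v by exact: fine_ge0.
have C0 : 0 < 1 + v * 3 `^ p by rewrite ltr_pwDl// mulr_ge0 ?powR_ge0.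
apply: (growth_exponent_le C0 ltr01) => a /andP[a0 a1].
apply: le_trans (@covering_le_variation _ _ cw p v a p1 a0 _) _; first by rewrite fineK.
have ia : 0 <= a^-1 by rewrite invr_ge0 ltW.
(* For a < 1 the additive 1 is at most a ^ (- p) and joins the constant. *)
rewrite lee_fin powRM// -(powR_inv1 (ltW a0)) -powRrM mulN1r mulrDl mul1r mulrA lerD2r.
rewrite powRN invf_ge1 ?powR_gt0//.
have e1 : 1 `^ p = 1 :> R by rewrite powR1.
rewrite -[leRHS]e1; apply: ge0_ler_powR; rewrite ?nnegrE ?(ltW a0) ?(ltW a1)//.
exact: le_trans p1.
Qed.

End exponents.

Theorem theorem3p10 (R : realType) (w : R -> R) (cw : cadlag w)
  (w_nonconst : exists s t : R, [/\ s \in `[0, 1], t \in `[0, 1] & w s != w t])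
  (U : R) (U01 : U \in `[0, 1])
  (U_min : Num.min (w U) (left_lim w U) = inf [set w t | t in `[0, 1]])
  (lam : {measure set (borel (tree cw)) -> \bar R})
  (lam_length : is_length_measure (\pi_(tree cw) (graph_low w U01)) lam) :
  let O := \pi_(tree cw) (graph_low w U01) in
  let V := variation_index `[0, 1] w in
  let V' := variation_index setT (@graph_path R w) in
  (forall p : R, 1 <= p ->
     pvariation `[0, 1] w p = pvariation setT (@graph_path R w) p) /\
  V' = V /\
  V = height_index O lam /\
  V = (growth_exponent (trim_length O lam) + 1)%E /\
  V = maxe (growth_exponent (nleaves O)) 1%E /\
  V = upper_dim (tree cw).
Proof.
move=> O V V'; have lamP := lam_length.2.
have lowU : low w U = inf [set w t | t in `[0, 1]] := U_min.
have VV p : 1 <= p -> pvariation `[0, 1] w p = pvariation setT (@graph_path R w) p.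
  exact: pvariation_graph.
have h1 : (V <= height_index O lam)%E.
  exact (variation_index_le_height U01 lowU lamP).
have h2 : (height_index O lam <= growth_exponent (trim_length O lam) + 1)%E.
  exact (height_index_le_length U01 lowU w_nonconst lamP).
have h3 : (growth_exponent (trim_length O lam) + 1 <=
    maxe (growth_exponent (nleaves O)) 1)%E.
  exact (length_exponent_le_leaves U01 lowU w_nonconst lamP).
have h4 : (maxe (growth_exponent (nleaves O)) 1 <= upper_dim (tree cw))%E.
  exact (leaves_exponent_le_dim cw U01 lowU w_nonconst).
have h5 : (upper_dim (tree cw) <= V)%E by exact: dim_le_variation_index.
split=> //; split.
  congr ereal_inf; apply/seteqP; split => _ [p [p1 hp] <-]; exists p => //;
    by split => //; rewrite ?VV// -VV.
(* The cycle closes, and every index is squeezed between equal ones. *)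
have e4 : V = upper_dim (tree cw).
  by apply: le_anti; rewrite h5 (le_trans h1)// (le_trans h2)// (le_trans h3).
split; first by apply: le_anti; rewrite h1 e4 (le_trans h2)// (le_trans h3).
split; first by apply: le_anti; rewrite (le_trans h1 h2) e4 (le_trans h3).
by split=> //; apply: le_anti; rewrite (le_trans h1 (le_trans h2 h3)) e4.
Qed.
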